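(* Suppose that: (A) each $f_i$ and each $h_i$ is proper, closed and convex, each $f_i$ is $L_i$-smooth for some $L_i>0$, each $f_i+h_i$ is bounded from below, and the problem $\min_{x\in\mathbb{R}^d}\sum_{i\in\mathcal V}(f_i(x)+h_i(x))$ has a non-empty optimal solution set; (B) for every $\alpha'>0$ the function $\mathbf{x}\mapsto f(\mathbf{x})+h(\mathbf{x})+\frac{1}{2\alpha'}\mathbf{x}^T(I-\mathbf{W})\mathbf{x}$ has a minimizer over $\mathbb{R}^{nd}$; (C) (partial asynchrony) there exist non-negative integers $B$ and $D$ such that for every $i\in\mathcal V$ and every $k\in\mathbb{N}_0$ at least one element of $\{k,\dots,k+B\}$ belongs to $\mathcal K_i$, and $k-D\le s_{ij}^k\le k$ for all $i\in\mathcal V$, $j\in\mathcal N_i$ and $k\in\mathcal K_i$; (D) $\displaystyle \alpha\in\Bigl(0,\,2\min_{i\in\mathcal V}\frac{w_{ii}}{L_i}\Bigr)$. Then, for any initial point $\mathbf{x}^0\in\mathbb{R}^{nd}$, the sequence $\{\mathbf{x}^k\}$ generated by the asynchronous Prox-DGD converges to a fixed point $\mathbf{x}^\star$ of the synchronous Prox-DGD. If, in addition, each $f_i$ is $\mu_i$-strongly convex for some $\mu_i>0$, then for all $k\in\mathbb{N}_0$ $$\|\mathbf{x}^k-\mathbf{x}^\star\|_\infty^b\le\rho^{\lfloor k/(B+D+1)\rfloor}\|\mathbf{x}^0-\mathbf{x}^\star\|_\infty^b,\qquad\text{where}\quad \rho=\sqrt{1-\alpha\min_{i\in\mathcal V}\Bigl(\mu_i\Bigl(2-\frac{\alpha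 L_i}{w_{ii}}\Bigr)\Bigr)}.$$
   Context: $\mathcal G=(\mathcal V,\mathcal E)$ is an undirected connected graph with vertex set $\mathcal V=\{1,\dots,n\}$; $\mathcal E$ contains no self-loops; $\mathcal N_i=\{j:\{i,j\}\in\mathcal E\}$ and $\bar{\mathcal N}_i=\mathcal N_i\cup\{i\}$. For each $i\in\mathcal V$, $f_i:\mathbb{R}^d\to\mathbb{R}$ and $h_i:\mathbb{R}^d\to\mathbb{R}\cup\{+\infty\}$. A differentiable function $f$ is $L$-smooth if $\|\nabla f(y)-\nabla f(x)\|\le L\|y-x\|$ for all $x,y$, and $\mu$-strongly convex if $\langle\nabla f(y)-\nabla f(x),y-x\rangle\ge\mu\|y-x\|^2$ for all $x,y$. For $\mathbf{x}=(x_1^T,\dots,x_n^T)^T\in\mathbb{R}^{nd}$ with $x_i\in\mathbb{R}^d$, put $f(\mathbf{x})=\sum_{i}f_i(x_i)$, $h(\mathbf{x})=\sum_i h_i(x_i)$, and $\|\mathbf{x}\|_\infty^b=\max_{i\in\mathcal V}\|x_i\|$ (Euclidean norm on each block). $W=(w_{ij})\in\mathbb{R}^{n\times n}$ is an averaging matrix associated with $\mathcal G$: it is symmetric and doubly stochastic (non-negative, rows and columns sum to 1), and $w_{ij}>0$ if $\{i,j\}\in\mathcal E$ or $i=j$, $w_{ij}=0$ otherwise. $\mathbf{W}=W\otimes I_d$. $\operatorname{prox}_{g}(x)=\arg\min_y\, g(y)+\frac12\|y-x\|^2$. Synchronous Prox-DGD with step-size $\alpha>0$: $\mathbf{x}^{k+1}=\operatorname{prox}_{\alpha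 h}(\mathbf{W}\mathbf{x}^k-\alpha\nabla f(\mathbf{x}^k))$; a fixed point is $\mathbf{x}^\star$ with $\mathbf{x}^\star=\operatorname{prox}_{\alpha h}(\mathbf{W}\mathbf{x}^\star-\alpha\nabla f(\mathbf{x}^\star))$. Asynchronous Prox-DGD with step-size $\alpha$: for each $i\in\mathcal V$ and $k\in\mathbb{N}_0=\{0,1,2,\dots\}$, $$x_i^{k+1}=\begin{cases}\operatorname{prox}_{\alpha h_i}\bigl(\sum_{j\in\bar{\mathcal N}_i}w_{ij}x_j^{s_{ij}^k}-\alpha\nabla f_i(x_i^k)\bigr),&k\in\mathcal K_i,\\ x_i^k,&\text{otherwise},\end{cases}$$ where $\mathcal K_i\subseteq\mathbb{N}_0$ is the set of iterations at which node $i$ is active (the sets $\mathcal K_i$ need not be disjoint), the integer $s_{ij}^k\in[0,k]$ is the iteration index of the most recent version of $x_j$ available to node $i$ at iteration $k$, and $s_{ii}^k=k$. *)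

(* Defs.v *)
From HB Require Import structures.
From mathcomp Require Import all_boot all_order all_algebra.
From mathcomp Require Import all_classical all_reals all_analysis.

Set Implicit Arguments.
Unset Strict Implicit.
Unset Printing Implicit Defensive.

Import Order.TTheory GRing.Theory Num.Theory.
Import numFieldNormedType.Exports.

Local Open Scope classical_set_scope.
Local Open Scope ring_scope.

(* The space R^{md} of stacked vectors (x_1; ...; x_m), with every x_i in R^d,
   is represented by 'M[R]_(m, d), the block x_i being [row i x]; R^d itself is
   'rV[R]_d = 'M[R]_(1, d).  The matrix (W (x) I_d) then acts as [W *m x].
   The library norm `|x| on matrices is the sup norm, whence [enorm] below. *)

Definition dot (R : realType) (m d : nat) (x y : 'M[R]_(m, d)) : R :=
  \sum_(i < m) \sum_(j < d) x i j * y i j.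

Definition enorm (R : realType) (m d : nat) (x : 'M[R]_(m, d)) : R :=
  Num.sqrt (dot x x).

Definition block_max_norm (R : realType) (m d : nat) (x : 'M[R]_(m, d)) : R :=
  \big[Num.max/0]_(i < m) enorm (row i x).

(* The minimum over a non-empty index set; the default value [F ord0] is itself
   one of the terms. *)
Definition min_ord (R : realType) (n : nat) (F : 'I_n.+1 -> R) : R :=
  \big[Num.min/F ord0]_(i < n.+1) F i.

(* Meaningful at points where f is differentiable; differentiability is
   required separately wherever it is assumed. *)
Definition grad (R : realType) (m d : nat) (f : 'M[R]_(m, d) -> R)
    (x : 'M[R]_(m, d)) : 'M[R]_(m, d) :=
  \matrix_(i < m, j < d) 'D_(delta_mx i j) f x.

Definition smooth (R : realType) (m d : nat) (L : R)
    (f : 'M[R]_(m, d) -> R) : Prop :=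
  (forall x, differentiable f x) /\
  (forall x y, enorm (grad f y - grad f x) <= L * enorm (y - x)).

Definition strongly_convex (R : realType) (m d : nat) (mu : R)
    (f : 'M[R]_(m, d) -> R) : Prop :=
  (forall x, differentiable f x) /\
  (forall x y, mu * enorm (y - x) ^+ 2 <= dot (grad f y - grad f x) (y - x)).

Section extended_valued.
Local Open Scope ereal_scope.

(* This includes the requirement that F takes its values in R U {+oo}. *)
Definition proper_fun (R : realType) (m d : nat)
    (F : 'M[R]_(m, d) -> \bar R) : Prop :=
  (forall x, F x != -oo) /\ (exists x, F x < +oo).

Definition closed_fun (R : realType) (m d : nat)
    (F : 'M[R]_(m, d) -> \bar R) : Prop :=
  closed [set p : 'M[R]_(m, d) * R | F p.1 <= p.2%:E].

(* Used for functions that never take the value -oo; recall 0 * +oo = 0. *)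
Definition convex_fun (R : realType) (m d : nat)
    (F : 'M[R]_(m, d) -> \bar R) : Prop :=
  forall (x y : 'M[R]_(m, d)) (t : R), (0 <= t <= 1)%R ->
    F (t *: x + (1 - t) *: y)%R <= t%:E * F x + (1 - t)%:E * F y.

Definition proper_closed_convex (R : realType) (m d : nat)
    (F : 'M[R]_(m, d) -> \bar R) : Prop :=
  [/\ proper_fun F, closed_fun F & convex_fun F].

(* A minimizer is a feasible point: the problem of minimizing F = +oo has no
   solution. *)
Definition argmin (R : realType) (m d : nat)
    (F : 'M[R]_(m, d) -> \bar R) : set 'M[R]_(m, d) :=
  [set x | F x < +oo /\ forall y, F x <= F y].

(* The minimizer exists and is unique when g is proper, closed and convex; [prox]
   is 0 when there is none. *)
Definition prox (R : realType) (m d : nat) (g : 'M[R]_(m, d) -> \bar R)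
    (x : 'M[R]_(m, d)) : 'M[R]_(m, d) :=
  xget 0%R (argmin (fun y => g y + (2^-1 * enorm (y - x) ^+ 2)%:E)).

Definition sep_sum (R : realType) (n d : nat) (f : 'I_n -> 'rV[R]_d -> R)
    (x : 'M[R]_(n, d)) : R :=
  (\sum_(i < n) f i (row i x))%R.

Definition sep_sum_ext (R : realType) (n d : nat)
    (h : 'I_n -> 'rV[R]_d -> \bar R) (x : 'M[R]_(n, d)) : \bar R :=
  \sum_(i < n) h i (row i x).

Definition consensus_objective (R : realType) (n d : nat)
    (f : 'I_n -> 'rV[R]_d -> R) (h : 'I_n -> 'rV[R]_d -> \bar R) :
    'rV[R]_d -> \bar R :=
  fun x => \sum_(i < n) ((f i x)%:E + h i x).

Definition penalized_objective (R : realType) (n d : nat)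
    (f : 'I_n -> 'rV[R]_d -> R) (h : 'I_n -> 'rV[R]_d -> \bar R)
    (W : 'M[R]_n) (a : R) : 'M[R]_(n, d) -> \bar R :=
  fun x => (sep_sum f x)%:E + sep_sum_ext h x
           + ((2 * a)^-1 * dot x ((1%:M - W) *m x))%:E.

Definition scale_ext (R : realType) (T : Type) (a : R) (g : T -> \bar R) :
    T -> \bar R :=
  fun x => a%:E * g x.

End extended_valued.

Definition connected_graph (n : nat) (e : rel 'I_n) : Prop :=
  [/\ symmetric e, irreflexive e & forall i j, connect e i j].

Definition closed_nbhd (n : nat) (e : rel 'I_n) (i j : 'I_n) : bool :=
  (j == i) || e i j.

Definition averaging_matrix (R : realType) (n : nat) (e : rel 'I_n)
    (W : 'M[R]_n) : Prop :=
  [/\ W^T = W,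
      (forall i j, 0 <= W i j),
      (forall i, \sum_(j < n) W i j = 1),
      (forall j, \sum_(i < n) W i j = 1) &
      (forall i j, (closed_nbhd e i j -> 0 < W i j) /\
                   (~~ closed_nbhd e i j -> W i j = 0))].

Definition sync_fixed_point (R : realType) (n d : nat)
    (f : 'I_n -> 'rV[R]_d -> R) (h : 'I_n -> 'rV[R]_d -> \bar R)
    (W : 'M[R]_n) (a : R) (x : 'M[R]_(n, d)) : Prop :=
  x = prox (scale_ext a (sep_sum_ext h)) (W *m x - a *: grad (sep_sum f) x).

(* [K i] is the set of iterations at which node i is active, and [s i j k] the
   index of the version of x_j used by node i at iteration k. *)
Definition async_prox_dgd (R : realType) (n d : nat) (e : rel 'I_n)
    (f : 'I_n -> 'rV[R]_d -> R) (h : 'I_n -> 'rV[R]_d -> \bar R)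
    (W : 'M[R]_n) (a : R) (K : 'I_n -> set nat) (s : 'I_n -> 'I_n -> nat -> nat)
    (x : nat -> 'M[R]_(n, d)) : Prop :=
  forall (i : 'I_n) (k : nat),
    (K i k ->
       row i (x k.+1) =
       prox (scale_ext a (h i))
         (\sum_(j < n | closed_nbhd e i j) W i j *: row j (x (s i j k))
          - a *: grad (f i) (row i (x k)))) /\
    (~ K i k -> row i (x k.+1) = row i (x k)).

Definition version_indices (n : nat) (e : rel 'I_n)
    (s : 'I_n -> 'I_n -> nat -> nat) : Prop :=
  (forall i j k, closed_nbhd e i j -> (s i j k <= k)%N) /\
  (forall i k, s i i k = k).

(* The bound k - D <= s i j k is over the integers; with the truncated
   subtraction of nat it says the same, since s i j k >= 0. *)
Definition partially_asynchronous (n : nat) (e : rel 'I_n)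
    (K : 'I_n -> set nat) (s : 'I_n -> 'I_n -> nat -> nat) (B D : nat) : Prop :=
  (forall i k, exists2 l, (k <= l <= k + B)%N & K i l) /\
  (forall i j k, e i j -> K i k -> (k - D <= s i j k <= k)%N).

(* Main.v *)
Require Import Defs.
From HB Require Import structures.
From mathcomp Require Import all_boot all_order all_algebra.
From mathcomp Require Import all_classical all_reals all_analysis.
From mathcomp Require Import lra ring zify.
Import Order.TTheory GRing.Theory Num.Theory.
Import numFieldNormedType.Exports.
Local Open Scope classical_set_scope.
Local Open Scope ring_scope.

(* Let T_i X = prox_{a h_i} (sum_j w_ij X_j - a grad f_i (X_i)) be the update of
   node i.  Cocoercivity of grad f_i, strict convexity of the squared norm and
   firm nonexpansiveness of prox give, with P = T_i X - T_i Y and some kappa > 0,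
     |P|^2 + kappa sum_j w_ij |X_j - Y_j - P|^2 <= sum_j w_ij |X_j - Y_j|^2.
   A minimizer of the penalized objective is a fixed point, so the errors with
   respect to it have a limsup V in block-max norm.  An active node whose error is
   nearly V must have averaged errors which are all nearly V and nearly equal;
   going back through the boundedly many updates which connect all nodes, on long
   windows all errors are nearly one common vector.  Hence x moves little there,
   every accumulation point is a fixed point, and the block-max distance to that
   point is nonincreasing, which gives convergence.  Under strong convexity each
   update contracts by rho, and every B + D + 1 iterations refresh all nodes and
   flush all delays. *)

Set Implicit Arguments.
Unset Strict Implicit.
Unset Printing Implicit Defensive.

(** * Euclidean geometry of stacked vectors *)

Section Euclid.
Variables (R : realType) (m d : nat).
Implicit Types (x y z : 'M[R]_(m, d)) (a : R).

Lemma dotC x y : dot x y = dot y x.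
Proof. by apply: eq_bigr => i _; apply: eq_bigr => j _; rewrite mulrC. Qed.

Lemma dotDl x y z : dot (x + y) z = dot x z + dot y z.
Proof.
rewrite /dot -big_split; apply: eq_bigr => i _ /=; rewrite -big_split.
by apply: eq_bigr => j _; rewrite mxE mulrDl.
Qed.

Lemma dotZl a x y : dot (a *: x) y = a * dot x y.
Proof.
rewrite /dot mulr_sumr; apply: eq_bigr => i _; rewrite mulr_sumr.
by apply: eq_bigr => j _; rewrite mxE mulrA.
Qed.

Lemma dotDr x y z : dot x (y + z) = dot x y + dot x z.
Proof. by rewrite dotC dotDl !(dotC _ x). Qed.

Lemma dotZr a x y : dot x (a *: y) = a * dot x y.
Proof. by rewrite dotC dotZl dotC. Qed.

Lemma dotNl x y : dot (- x) y = - dot x y.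
Proof. by rewrite -scaleN1r dotZl mulN1r. Qed.

Lemma dotNr x y : dot x (- y) = - dot x y.
Proof. by rewrite dotC dotNl dotC. Qed.

Lemma dot0l x : dot 0 x = 0.
Proof. by rewrite -(scale0r 0) dotZl mul0r. Qed.

Lemma dot_suml (I : finType) (F : I -> 'M[R]_(m, d)) y :
  dot (\sum_i F i) y = \sum_i dot (F i) y.
Proof.
by elim/big_rec2: _ => [|i _ a _ <-]; rewrite ?dot0l ?dotDl.
Qed.

Lemma dot_ge0 x : 0 <= dot x x.
Proof.
by apply: sumr_ge0 => i _; apply: sumr_ge0 => j _; rewrite -expr2 sqr_ge0.
Qed.

Lemma sqr_entry_le_dot x i j : x i j ^+ 2 <= dot x x.
Proof.
rewrite /dot (bigD1 i) //= (bigD1 j) //= expr2 -addrA lerDl addr_ge0 //.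
  by apply: sumr_ge0 => k _; rewrite -expr2 sqr_ge0.
by apply: sumr_ge0 => k _; apply: sumr_ge0 => l _; rewrite -expr2 sqr_ge0.
Qed.

Lemma dot_eq0 x : dot x x <= 0 -> x = 0.
Proof.
move=> x0; apply/matrixP => i j; rewrite mxE; apply/eqP.
rewrite -sqrf_eq0 eq_le sqr_ge0 andbT.
exact: le_trans (sqr_entry_le_dot x i j) x0.
Qed.

Lemma dot_le_entries x a : (forall i j, `|x i j| <= a) ->
  dot x x <= (m * d)%:R * a ^+ 2.
Proof.
move=> xa; rewrite natrM -mulrA.
have bound (k : nat) (F : 'I_k -> R) b :
    (forall i, F i <= b) -> \sum_i F i <= k%:R * b.
  by move=> Fb; rewrite -[k in k%:R]card_ord mulr_natl -sumr_const ler_sum.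
apply: (bound) => i; apply: bound => j; rewrite -expr2 -real_normK ?num_real //.
by rewrite lerXn2r ?nnegrE // (le_trans _ (xa i j)).
Qed.

Lemma dot_row x y : dot x y = \sum_i dot (row i x) (row i y).
Proof.
apply: eq_bigr => i _; rewrite /dot big_ord_recl big_ord0 addr0.
by apply: eq_bigr => j _; rewrite !mxE.
Qed.

Lemma sqr_enorm x : enorm x ^+ 2 = dot x x.
Proof. by rewrite /enorm sqr_sqrtr ?dot_ge0. Qed.

Lemma enorm_ge0 x : 0 <= enorm x.
Proof. exact: sqrtr_ge0. Qed.

Lemma enorm_le x a : 0 <= a -> (enorm x <= a) = (dot x x <= a ^+ 2).
Proof.
by move=> a0; rewrite -sqr_enorm ler_sqr ?nnegrE ?enorm_ge0.
Qed.

Lemma dot_youngD x y : dot (x + y) (x + y) <= 2 * dot x x + 2 * dot y y.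
Proof.
have := dot_ge0 (x - y); rewrite !(dotDl, dotDr, dotNl, dotNr) (dotC y x).
lra.
Qed.

Lemma dot_young x y a : 0 < a -> 2 * dot x y <= a * dot x x + a^-1 * dot y y.
Proof.
move=> a0; rewrite -(ler_pM2l a0) [leRHS]mulrDr mulVKf ?gt_eqF // -subr_ge0.
have := dot_ge0 (a *: x - y); congr (0 <= _).
by rewrite !(dotDl, dotDr, dotNl, dotNr, dotZl, dotZr) (dotC y x); ring.
Qed.

(** The variance identity: it keeps the exact gap in Jensen's inequality for the squared norm, a
    slack term that later measures disagreement. *)
Lemma dot_weighted_mean (I : finType) (w : I -> R) (v : I -> 'M[R]_(m, d)) :
  \sum_i w i = 1 -> let u := \sum_i w i *: v i in
  dot u u + \sum_i w i * dot (v i - u) (v i - u) = \sum_i w i * dot (v i) (v i).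
Proof.
move=> w1 u.
have uu : \sum_i w i * dot (v i) u = dot u u.
  by rewrite {2}/u dot_suml; apply: eq_bigr => i _; rewrite dotZl.
have -> : \sum_i w i * dot (v i - u) (v i - u) =
    \sum_i w i * dot (v i) (v i) - 2 * dot u u + dot u u.
  have uw : \sum_i w i * dot u u = dot u u by rewrite -mulr_suml w1 mul1r.
  rewrite -[X in _ = _ + X]uw -{1}uu mulr_sumr -sumrB.
  rewrite -big_split; apply: eq_bigr => i _ /=.
  by rewrite !(dotDl, dotDr, dotNl, dotNr) (dotC u); ring.
by ring.
Qed.

End Euclid.

(** Bolzano-Weierstrass. [mxvec] moves to row vectors, where bounded closed sets are compact; an
    entry whose square is at most M has absolute value at most M + 1. *)
Lemma bounded_seq_accumulation (R : realType) (m d : nat)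
    (x : nat -> 'M[R]_(m, d)) (M : R) :
  (forall k, dot (x k) (x k) <= M) ->
  exists y, forall (eps : R) (N : nat), 0 < eps ->
    exists2 k, (N <= k)%N & dot (x k - y) (x k - y) <= eps.
Proof.
move=> xM.
pose A := [set v : 'rV[R]_(m * d) | `|v| <= M + 1].
have M0 : 0 <= M := le_trans (dot_ge0 (x 0%N)) (xM 0%N).
have cA : compact A.
  apply: bounded_closed_compact.
    exists (M + 1); split; first exact: num_real.
    by move=> r Mr v /= vM; exact: le_trans vM (ltW Mr).
  apply: (@preimage_closed _ _ (fun v : 'rV[R]_(m * d) => `|v|) [set r | r <= M + 1]).
    by move=> v _; exact: norm_continuous.
  exact: closed_le.
have xA k : A (mxvec (x k)).
  rewrite /A /= [leLHS]/Num.norm /= mx_normrE.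
  apply/bigmax_leP => /=; split=> [|[i j] _ /=]; first by rewrite addr_ge0.
  rewrite (ord1 i) {i}; case/mxvec_indexP: j => i j; rewrite mxvecE.
  have := le_trans (sqr_entry_le_dot (x k) i j) (xM k).
  rewrite -real_normK ?num_real // => h.
  have := normr_ge0 (x k i j); nra.
have [z [_ clz]] : A `&` cluster (mxvec (x k) @[k --> \oo]) !=set0.
  by apply: cA; exists 0%N => // k _; exact: xA.
exists (vec_mx z) => eps N eps0.
pose c : R := (m * d)%:R + 1.
have c0 : 0 < c by rewrite ltr_pwDr.
(* As e <= 1, the squared distance is at most m d e^2 <= c e <= eps; the 1 added in [c] avoids a
   division by 0. *)
pose e := Num.min 1 (eps / c).
have e0 : 0 < e by rewrite lt_min ltr01 divr_gt0.
have [] := clz [set mxvec (x k) | k in [set k | (N <= k)%N]] (ball z e).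
- by exists N => // k /= Nk; exists k.
- exact: nbhsx_ballx.
move=> _ [[k /= Nk <-]]; rewrite -ball_normE /= => zk; exists k => //.
apply: (@le_trans _ _ ((m * d)%:R * e ^+ 2)).
  apply: dot_le_entries => i j; rewrite !mxE distrC; apply: le_trans (ltW zk).
  rewrite [leRHS]/Num.norm /= mx_normrE.
  apply: (le_trans _ (le_bigmax _ _ (ord0, mxvec_index i j))) => /=.
  by rewrite !mxE mxvecE.
have e1 : e <= 1 by rewrite ge_min lexx.
have ec : e <= eps / c by rewrite ge_min lexx orbT.
apply: (@le_trans _ _ (c * e)).
  rewrite expr2 mulrA ler_wpM2r ?(ltW e0) // /c.
  by have : 0 <= (m * d)%:R :> R by []; nra.
by rewrite mulrC -ler_pdivlMr.
Qed.

(** * Smooth convex functions *)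

Section Gradient.
Variables (R : realType) (m d : nat).
Implicit Types (f : 'M[R]_(m, d) -> R) (x y v : 'M[R]_(m, d)).

Lemma derive_grad f x v : differentiable f x -> 'D_v f x = dot (grad f x) v.
Proof.
move=> df; rewrite deriveE // [in LHS](matrix_sum_delta v) linear_sum.
apply: eq_bigr => i _; rewrite linear_sum; apply: eq_bigr => j _.
by rewrite linearZ /= mxE deriveE // mulrC.
Qed.

Lemma grad_first_order f x v (eps : R) : differentiable f x -> 0 < eps ->
  exists2 delta : R, 0 < delta & forall t, 0 < t < delta ->
    `|f (t *: v + x) - f x - t * dot (grad f x) v| <= eps * t.
Proof.
move=> df eps0; have cv := @diff_derivable _ _ _ _ _ v df.
have /cvgrPdist_lt /(_ eps eps0) := cv.
rewrite -[lim _]/('D_v f x) derive_grad // => -[delta /= delta0 H].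
exists delta => // t /andP[t0 td].
have := H t; rewrite /ball /= sub0r normrN gtr0_norm // => /(_ td).
rewrite gt_eqF // => /(_ isT) /ltW h.
rewrite -[X in `|X - _|](mulVKf (lt0r_neq0 t0)) -mulrBr normrM gtr0_norm //.
by rewrite mulrC ler_pM2r // distrC.
Qed.

Lemma is_derive_line f x v (t : R) : (forall y, differentiable f y) ->
  is_derive t 1 (fun t => f (t *: v + x)) (dot (grad f (t *: v + x)) v).
Proof.
move=> df; have dft := df (t *: v + x).
have quot : (fun h : R => h^-1 *: (((fun t => f (t *: v + x)) \o shift t) (h *: 1)
      - f (t *: v + x))) =
    (fun h => h^-1 *: ((f \o shift (t *: v + x)) (h *: v) - f (t *: v + x))).
  by apply: funext => h /=; rewrite [h *: 1]mulr1 scalerDl addrA.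
split; first by rewrite /derivable quot; exact: diff_derivable.
by rewrite /derive quot -[LHS]/('D_v f (t *: v + x)) derive_grad.
Qed.

Lemma smooth_sqr L f x y : 0 <= L -> smooth L f ->
  dot (grad f y - grad f x) (grad f y - grad f x) <= L ^+ 2 * dot (y - x) (y - x).
Proof.
move=> L0 [_ /(_ x y)]; rewrite enorm_le ?mulr_ge0 ?enorm_ge0 //.
by rewrite exprMn sqr_enorm.
Qed.

(** Along the segment, f minus its quadratic upper model has a nonpositive derivative, so the mean
    value theorem replaces integration of the gradient. *)
Lemma descent L f x v : 0 < L -> smooth L f ->
  f (v + x) <= f x + dot (grad f x) v + L / 2 * dot v v.
Proof.
move=> L0 sf; have df := sf.1.
pose g t := f (t *: v + x).
pose b t : R := t * dot (grad f x) v + t ^+ 2 * (L / 2 * dot v v).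
pose dg t := dot (grad f (t *: v + x)) v.
pose db t := dot (grad f x) v + t * (L * dot v v).
have dphi (t : R) : is_derive t 1 (g - b) (dg t - db t).
  apply: is_deriveB; first exact: is_derive_line.
  rewrite /b; apply: is_derive_eq.
  by rewrite /GRing.scale /= /db; field.
have cphi : {within `[0, 1], continuous (g - b)}.
  apply: derivable_within_continuous => r _; exact: ex_derive.
have [t] := MVT ltr01 (fun t _ => dphi t) cphi.
rewrite in_itv /= => /andP[t0 t1].
rewrite subr0 mulr1 -[(g - b) 1]/(g 1 - b 1) -[(g - b) 0]/(g 0 - b 0).
rewrite /g /b scale1r scale0r add0r => mvt.
suff : dg t - db t <= 0.
  by rewrite -mvt expr1n expr0n /= !mul1r !mul0r; lra.
have -> : dg t - db t = dot (grad f (t *: v + x) - grad f x) v - t * (L * dot v v).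
  by rewrite dotDl dotNl /dg /db; ring.
have Lt0 : 0 < L * t by rewrite mulr_gt0.
have iLt0 : 0 < (L * t)^-1 by rewrite invr_gt0.
(* Young's inequality with weight 1/(L t) stands in for Cauchy-Schwarz: each of its two terms is at
   most L t |v|^2. *)
have := dot_young (grad f (t *: v + x) - grad f x) v iLt0; rewrite invrK.
have := @smooth_sqr L f x (t *: v + x) (ltW L0) sf.
rewrite addrK dotZl dotZr => h.
have := ler_wpM2l (ltW iLt0) h.
have -> : (L * t)^-1 * (L ^+ 2 * (t * (t * dot v v))) = L * t * dot v v.
  by field; rewrite !gt_eqF.
lra.
Qed.

(** Compare the chord bound with the first-order expansion at x + t (y - x), whose error is at most
    eps t, and divide by t. *)
Lemma convex_grad f x y : differentiable f x -> convex_fun (fun z => (f z)%:E) ->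
  f x + dot (grad f x) (y - x) <= f y.
Proof.
move=> df cf; apply/ler_addgt0Pr => eps eps0.
have [delta delta0 /= approx] := grad_first_order (y - x) df eps0.
pose t := Num.min 1 (delta / 2).
have t0 : 0 < t by rewrite lt_min ltr01 divr_gt0.
have t1 : t <= 1 by rewrite ge_min lexx.
have td : t < delta.
  by apply: (@le_lt_trans _ _ (delta / 2)); [rewrite ge_min lexx orbT|lra].
have := approx t; rewrite t0 td => /(_ isT).
have := cf y x t; rewrite (ltW t0) t1 => /(_ isT).
rewrite -!EFinM -EFinD lee_fin.
have -> : t *: y + (1 - t) *: x = t *: (y - x) + x.
  by rewrite scalerBr scalerBl scale1r -addrA [- _ + x]addrC.
move=> h /ler_normlP[h1 h2].
by rewrite -(ler_pM2l t0); nra.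
Qed.

(** The Baillon-Haddad inequality. For [half], the value of f at w - g / L, with g the difference of
    gradients, lies above the tangent at u and below the quadratic model at w. Adding [half] to its
    copy with the points exchanged cancels the values of f. *)
Lemma cocoercive L f x y : 0 < L -> convex_fun (fun z => (f z)%:E) -> smooth L f ->
  dot (grad f y - grad f x) (grad f y - grad f x) <=
  L * dot (grad f y - grad f x) (y - x).
Proof.
move=> L0 cf sf.
suff half u w : f u + dot (grad f u) (w - u) +
    (2 * L)^-1 * dot (grad f w - grad f u) (grad f w - grad f u) <= f w.
  have := half x y; have := half y x.
  rewrite -(opprB (grad f y)) -(opprB y) dotNl !dotNr opprK.
  set N := dot (_ - _) (_ - _); move=> h1 h2.
  have h : L^-1 * N <= dot (grad f y - grad f x) (y - x).
    rewrite [in leRHS]dotDl [in leRHS]dotNl.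
    have -> : L^-1 * N = (2 * L)^-1 * N + (2 * L)^-1 * N.
      by field; rewrite gt_eqF.
    lra.
  by rewrite -(ler_pM2l L0) mulVKf ?gt_eqF // in h.
set g := grad f w - grad f u.
have h1 := convex_grad (L^-1 *: - g + w) (sf.1 u) cf.
have h2 := descent w (L^-1 *: - g) L0 sf.
have e1 : dot (grad f u) (L^-1 *: - g + w - u) =
    dot (grad f u) (w - u) - L^-1 * dot (grad f u) g.
  by rewrite -addrA dotDr dotZr dotNr; ring.
have e2 : dot (grad f w) (L^-1 *: - g) = - L^-1 * (dot g g + dot (grad f u) g).
  have {1}-> : grad f w = g + grad f u by rewrite /g subrK.
  by rewrite dotZr dotNr dotDl; ring.
have e3 : L / 2 * dot (L^-1 *: - g) (L^-1 *: - g) = (2 * L)^-1 * dot g g.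
  by rewrite dotZl dotZr dotNl dotNr; field; rewrite gt_eqF.
have e4 : L^-1 * dot g g = (2 * L)^-1 * dot g g + (2 * L)^-1 * dot g g.
  by field; rewrite gt_eqF.
rewrite e1 in h1; rewrite e2 e3 in h2.
lra.
Qed.

End Gradient.

(** The difference quotients themselves coincide, because moving entry (i, j) changes only the i-th
    summand. *)
Lemma row_grad_sep_sum (R : realType) (n d : nat) (f : 'I_n -> 'rV[R]_d -> R)
    (x : 'M[R]_(n, d)) i :
  row i (grad (sep_sum f) x) = grad (f i) (row i x).
Proof.
apply/rowP => j; rewrite !mxE /derive.
apply: (congr1 (fun q : R -> R => lim (q t @[t --> 0^']))).
apply: funext => h /=; congr (_ *: _).
rewrite /sep_sum -sumrB (bigD1 i) //= big1 ?addr0.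
  by rewrite linearD linearZ /= [row i (delta_mx _ _)]rowE mul_delta_mx.
move=> k ki; rewrite linearD linearZ /= [row k (delta_mx _ _)]rowE.
by rewrite mul_delta_mx_0 // scaler0 add0r subrr.
Qed.

(** * The proximal operator *)

Section Prox.
Variables (R : realType) (m d : nat).
Implicit Types (h : 'M[R]_(m, d) -> \bar R) (u v p q y : 'M[R]_(m, d)) (a : R).

(* The first-order characterization of p = prox_{a h}(u), namely
   u - p \in a * \partial h(p). *)
Definition prox_vi a h u p : Prop :=
  exists2 r, h p = r%:E &
    forall y s, h y = s%:E -> dot (u - p) (y - p) <= a * (s - r).

(** Quadratic growth around p, from strong convexity of the prox objective; it gives minimality and
    uniqueness at once. *)
Lemma prox_vi_growth a h u p y r s : prox_vi a h u p ->
  h p = r%:E -> h y = s%:E ->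
  a * r + 2^-1 * dot (p - u) (p - u) + 2^-1 * dot (y - p) (y - p) <=
  a * s + 2^-1 * dot (y - u) (y - u).
Proof.
move=> [r' hp' vi] hp hy; have := vi y s hy.
have -> : r' = r by apply: EFin_inj; rewrite -hp -hp'.
have -> : y - u = (y - p) + (p - u) by rewrite addrA subrK.
rewrite -(opprB p u) dotNl; move: (y - p) (p - u) => b c.
by rewrite !(dotDl, dotDr) (dotC c b); lra.
Qed.

(** Since p is a minimizer, [xget] returns some minimizer rather than its default 0, and quadratic
    growth identifies it with p. *)
Lemma prox_vi_prox a h u p : 0 < a -> (forall y, h y != -oo%E) ->
  prox_vi a h u p -> prox (scale_ext a h) u = p.
Proof.
move=> a0 hNy vi; have [r hp _] := vi.
pose G y := (scale_ext a h y + (2^-1 * enorm (y - u) ^+ 2)%:E)%E.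
have Gfin y s : h y = s%:E -> G y = (a * s + 2^-1 * dot (y - u) (y - u))%:E.
  by move=> hy; rewrite /G /scale_ext hy sqr_enorm.
have Ginf y : h y = +oo%E -> G y = +oo%E.
  by move=> hy; rewrite /G /scale_ext hy gt0_muley ?lte_fin // addye.
have Gp : argmin G p.
  rewrite /argmin /= (Gfin p r hp); split; first exact: ltry.
  move=> y; case hy: (h y) => [s| |].
  - rewrite (Gfin y s hy) lee_fin.
    apply: le_trans (prox_vi_growth vi hp hy).
    by rewrite lerDl mulr_ge0 ?dot_ge0 ?invr_ge0.
  - by rewrite Ginf ?leey.
  - by have := hNy y; rewrite hy.
have : argmin G (prox (scale_ext a h) u) := xgetPex 0 (ex_intro _ p Gp).
move: (prox _ _) => q [Gqy /(_ p) Gqp].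
case hq: (h q) => [s| |].
- move: Gqp; rewrite (Gfin q s hq) (Gfin p r hp) lee_fin => Gqp.
  have := prox_vi_growth vi hp hq => gr.
  by apply/eqP; rewrite -subr_eq0; apply/eqP/dot_eq0; lra.
- by move: Gqy; rewrite Ginf.
- by have := hNy q; rewrite hq.
Qed.

(** Test each variational inequality at the other point and add: the subdifferential is monotone. *)
Lemma prox_vi_firm a h u v p q : prox_vi a h u p -> prox_vi a h v q ->
  dot (p - q) (p - q) + dot ((u - v) - (p - q)) ((u - v) - (p - q)) <=
  dot (u - v) (u - v).
Proof.
move=> [r hp vip] [s hq viq]; have := vip q s hq; have := viq p r hp.
rewrite -(opprB p q) dotNr => h1 h2.
have : 0 <= dot ((u - v) - (p - q)) (p - q).
  have -> : (u - v) - (p - q) = (u - p) - (v - q).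
    by rewrite !opprB addrACA [in RHS]addrACA [- v + _]addrC.
  by rewrite dotDl dotNl; lra.
move: (u - v) (p - q) => b c.
by rewrite !(dotDl, dotDr, dotNl, dotNr) (dotC c b); lra.
Qed.

(** Compare p with t y + (1 - t) p and divide by t; t is small enough for the remaining t |y - p|^2
    / 2 to stay below eps. *)
Lemma convex_argmin_prox_vi a h u p : 0 < a -> (forall y, h y != -oo%E) ->
  convex_fun h ->
  argmin (fun y => a%:E * h y + (2^-1 * dot (y - u) (y - u))%:E)%E p ->
  prox_vi a h u p.
Proof.
move=> a0 hNy ch [Gpy Gp].
case hp: (h p) => [r| |]; last 2 first.
- by move: Gpy; rewrite hp gt0_muley ?lte_fin // addye.
- by have := hNy p; rewrite hp.
exists r => // y s hy; rewrite -subr_ge0; apply/ler_addgt0Pr => eps eps0.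
set N := dot (y - p) (y - p).
have N0 : 0 <= N by exact: dot_ge0.
pose t := Num.min 1 (eps / (N + 1)).
have t0 : 0 < t by rewrite lt_min ltr01 divr_gt0 // ltr_pwDr.
have t1 : t <= 1 by rewrite ge_min lexx.
have tN : t * (N + 1) <= eps.
  by rewrite -ler_pdivlMr ?ltr_pwDr // ge_min lexx orbT.
have := ch y p t; rewrite (ltW t0) t1 hy hp -!EFinM -EFinD => /(_ isT) cht.
case hz: (h (t *: y + (1 - t) *: p)) cht => [z| |]; last 2 first.
- by rewrite leye_eq.
- by have := hNy (t *: y + (1 - t) *: p); rewrite hz.
rewrite lee_fin => cht.
have := Gp (t *: y + (1 - t) *: p); rewrite hz hp -!EFinM -!EFinD lee_fin.
have -> : t *: y + (1 - t) *: p - u = (p - u) + t *: (y - p).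
  rewrite scalerBr scalerBl scale1r (addrC (p - u)) !addrA addrAC.
  by rewrite (addrAC _ (- (t *: p))).
rewrite -(opprB p u) dotNl => Gt; rewrite -(ler_pM2l t0) mulr0.
move: t Gt t0 t1 tN cht hz N0; rewrite /N => t Gt t0 _ tN cht _.
move: (y - p) (p - u) Gt tN => b c Gt tN N0; move: Gt.
rewrite !(dotDl, dotDr, dotZl, dotZr) (dotC b c) => Gt.
have := ler_wpM2l (ltW a0) cht.
nra.
Qed.

End Prox.

Lemma continuous_sqr_dist (R : realType) (m d : nat) (u : 'M[R]_(m, d)) :
  continuous (fun z : 'M[R]_(m, d) => dot (z - u) (z - u)).
Proof.
rewrite /dot; apply: continuous_big => [|i _]; first exact: add_continuous.
apply: continuous_big => [|j _]; first exact: add_continuous.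
have cij : continuous (fun z : 'M[R]_(m, d) => (z - u) i j).
  move=> z; have -> : (fun z : 'M[R]_(m, d) => (z - u) i j) =
      (fun z => z i j - u i j) by apply: funext => y; rewrite !mxE.
  by apply: continuousB; [exact: coord_continuous|exact: cst_continuous].
by move=> z; apply: continuousM; exact: cij.
Qed.

Lemma compact_dot_ball (R : realType) (d : nat) (u : 'rV[R]_d) (M : R) :
  compact [set z | dot (z - u) (z - u) <= M].
Proof.
apply: bounded_closed_compact; last first.
  rewrite -[X in closed X]/((fun z => dot (z - u) (z - u)) @^-1` [set r | r <= M]).
  apply: preimage_closed.
    by move=> z _; exact: continuous_sqr_dist.
  exact: closed_le.
exists (`|u| + M + 1); split; first exact: num_real.
move=> r ltr z /= zM; apply: le_trans (ltW ltr).
have M0 : 0 <= M := le_trans (dot_ge0 _) zM.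
have -> : z = u + (z - u) by rewrite addrC subrK.
apply: le_trans (ler_normD _ _) _; rewrite -addrA lerD2l.
rewrite [leLHS]/Num.norm /= mx_normrE.
apply/bigmax_leP => /=; split=> [|[i j] _ /=]; first by rewrite addr_ge0.
have := le_trans (sqr_entry_le_dot (z - u) i j) zM.
rewrite -real_normK ?num_real //.
have := normr_ge0 ((z - u) i j); nra.
Qed.

(* Existence at u0 alone provides an affine minorant of h, which makes
   h + |. - u|^2 / 2 coercive for every u. *)
Lemma prox_vi_exists (R : realType) (d : nat) (h : 'rV[R]_d -> \bar R) (a : R)
    (u0 p0 u : 'rV[R]_d) : 0 < a -> proper_closed_convex h ->
  prox_vi a h u0 p0 -> exists p, prox_vi a h u p.
Proof.
move=> a0 [[hNy _] clh ch] [r0 hp0 vi].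
(* Minimizing over the epigraph makes the value of h a coordinate: the objective becomes continuous,
   and closedness of h is closedness of the constraint set. *)
pose F (q : 'rV[R]_d * R) : R := a * q.2 + 2^-1 * dot (q.1 - u) (q.1 - u).
have cF : continuous F.
  move=> q; apply: cvgD; apply: cvgM; [exact: cvg_cst|exact: cvg_snd|exact: cvg_cst|].
  exact: (continuous_comp cvg_fst (@continuous_sqr_dist _ _ _ u q.1)).
pose E := [set q | (h q.1 <= q.2%:E)%E] `&` [set q | F q <= F (p0, r0)].
pose g := u0 - p0.
pose M := 4 * (F (p0, r0) - a * r0 + dot g g - dot g (u - p0)).
have minorant z v : (h z <= v%:E)%E ->
    a * r0 - dot g g - 4^-1 * dot (z - u) (z - u) + dot g (u - p0) <= a * v.
  case hz: (h z) => [r| |] // hzv; last by have := hNy z; rewrite hz.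
  rewrite lee_fin in hzv; have := vi z r hz.
  have -> : z - p0 = (z - u) + (u - p0) by rewrite addrA subrK.
  (* Weight 2 costs only |z - u|^2 / 4, so half of the quadratic term in [F] survives and bounds the
     sublevel set by [M]. *)
  have := @dot_young _ _ _ (- g) (z - u) 2 (ltr0Sn _ 1).
  have := ler_wpM2l (ltW a0) hzv.
  rewrite -/g !(dotNl g) dotNr opprK (dotDr g (z - u)); lra.
have EM z v : E (z, v) -> dot (z - u) (z - u) <= M /\ a * v <= F (p0, r0).
  move=> [/= /minorant hzv]; rewrite {1}/F /= => Fzv.
  by have := dot_ge0 (z - u); split; rewrite /M; lra.
pose lo := (a * r0 - dot g g - 4^-1 * M + dot g (u - p0)) / a.
have cE : compact E.
  apply: (subclosed_compact _ (compact_setX (@compact_dot_ball _ _ u M)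
    (@segment_compact _ lo (F (p0, r0) / a)))).
    apply: closedI; first exact: clh.
    apply: (@preimage_closed _ _ F [set r | r <= F (p0, r0)]); last exact: closed_le.
    by move=> q _; exact: cF.
  move=> [z v] Ezv /=; have [zM vM] := EM z v Ezv; split=> //=.
  rewrite in_itv /= /lo ler_pdivrMr // ler_pdivlMr // !(mulrC v) vM andbT.
  have := minorant z v Ezv.1; lra.
have E0 : E (p0, r0) by split; rewrite /= ?hp0.
have [[p r]] := compact_EVT_min (ex_intro _ _ E0) cE (continuous_subspaceT cF).
rewrite inE => -[/= hpr Fpr] minF; exists p.
have argp y s : h y = s%:E -> a * r + 2^-1 * dot (p - u) (p - u) <= F (y, s).
  move=> hy; case: (leP (F (y, s)) (F (p0, r0))) => [le|/ltW].
    by apply: (minF (y, s)); rewrite inE; split; rewrite /= ?hy.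
  by apply: le_trans.
case hp: (h p) hpr => [s| |] //; last by have := hNy p; rewrite hp.
rewrite lee_fin => sr.
apply: convex_argmin_prox_vi => //; split; rewrite hp; first exact: ltry.
move=> y; case hy: (h y) => [t| |].
- rewrite -!EFinM -!EFinD lee_fin; apply: le_trans (argp y t hy).
  by rewrite lerD2r ler_pM2l.
- by rewrite gt0_muley ?lte_fin // addye // leey.
- by have := hNy y; rewrite hy.
Qed.

(** * Fixed points *)

Lemma dot_mulmxl (R : realType) (n d : nat) (A : 'M[R]_n) (x y : 'M[R]_(n, d)) :
  dot (A *m x) y = dot x (A^T *m y).
Proof.
have dot_tr (u v : 'M[R]_(n, d)) : dot u v = \tr (u^T *m v).
  rewrite /dot /mxtrace exchange_big; apply: eq_bigr => j _ /=.
  by rewrite mxE; apply: eq_bigr => i _; rewrite mxE.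
by rewrite !dot_tr trmx_mul -mulmxA.
Qed.

Section Separable.
Variables (R : realType) (n d : nat) (h : 'I_n -> 'rV[R]_d -> \bar R).
Hypothesis hNy : forall i y, h i y != -oo%E.
Implicit Types z : 'M[R]_(n, d).

Lemma sep_sum_ext_gtNy z : sep_sum_ext h z != -oo%E.
Proof.
by apply/eqP => /eqP; rewrite esum_eqNy => /existsP[i /andP[_]]; apply/negP/hNy.
Qed.

Lemma sep_sum_ext_lty z : (sep_sum_ext h z < +oo)%E ->
  exists r : 'I_n -> R, forall i, h i (row i z) = (r i)%:E.
Proof.
rewrite ltey => hz; exists (fun i => fine (h i (row i z))) => i.
rewrite fineK // fin_numE hNy /=; apply: contra hz => hi.
rewrite /sep_sum_ext esum_eqy; first by apply/existsP; exists i.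
by move=> j _; exact: hNy.
Qed.

Lemma sep_sum_ext_fin z r : (forall i, h i (row i z) = (r i)%:E) ->
  sep_sum_ext h z = (\sum_i r i)%:E.
Proof. by move=> hr; rewrite -sumEFin; apply: eq_bigr => i _. Qed.

Lemma sep_sum_ext_prox_vi a (u z : 'M[R]_(n, d)) :
  (forall i, prox_vi a (h i) (row i u) (row i z)) ->
  prox_vi a (sep_sum_ext h) u z.
Proof.
move=> vi.
have [r hr] : exists r : 'I_n -> R, forall i, h i (row i z) = (r i)%:E.
  exists (fun i => fine (h i (row i z))) => i.
  by have [s -> _] := vi i.
exists (\sum_i r i); first exact: sep_sum_ext_fin.
move=> y s hy.
have [r' hr'] : exists r' : 'I_n -> R, forall i, h i (row i y) = (r' i)%:E.
  by apply: sep_sum_ext_lty; rewrite hy ltry.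
have -> : s = \sum_i r' i by apply: EFin_inj; rewrite -hy (sep_sum_ext_fin hr').
rewrite -sumrB mulr_sumr dot_row; apply: ler_sum => i _.
have [s' hs' /(_ _ _ (hr' i))] := vi i; rewrite !linearB /=.
by have -> : s' = r i by apply: EFin_inj; rewrite -hr hs'.
Qed.

End Separable.

Section FixedPoint.
Variables (R : realType) (n d : nat) (W : 'M[R]_n).
Variables (f : 'I_n -> 'rV[R]_d -> R) (h : 'I_n -> 'rV[R]_d -> \bar R).
Hypothesis df : forall i x, differentiable (f i) x.
Hypothesis hNy : forall i y, h i y != -oo%E.

(** A family of blocks instead of a matrix, so that a node can be fed versions of different ages. *)
Definition dgd_point (a : R) i (X : 'I_n -> 'rV[R]_d) : 'rV[R]_d :=
  \sum_j W i j *: X j - a *: grad (f i) (X i).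

Definition prox_dgd_map (a : R) i (X : 'I_n -> 'rV[R]_d) : 'rV[R]_d :=
  prox (scale_ext a (h i)) (dgd_point a i X).

Lemma row_mulmx (A : 'M[R]_n) (z : 'M[R]_(n, d)) i :
  row i (A *m z) = \sum_j A i j *: row j z.
Proof. by rewrite row_mul mulmx_sum_row; apply: eq_bigr => j _; rewrite mxE. Qed.

Lemma row_dgd_point a z i :
  row i (W *m z - a *: grad (sep_sum f) z) = dgd_point a i (fun j => row j z).
Proof. by rewrite !linearB /= linearZ /= row_grad_sep_sum row_mulmx. Qed.

Lemma prox_vi_sync_fixed_point a z : 0 < a ->
  (forall i, prox_vi a (h i) (dgd_point a i (fun j => row j z)) (row i z)) ->
  sync_fixed_point f h W a z.
Proof.
move=> a0 vi; apply/esym/prox_vi_prox => //; first exact: sep_sum_ext_gtNy.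
by apply: sep_sum_ext_prox_vi => // i; rewrite row_dgd_point.
Qed.

Hypothesis symW : W^T = W.
Hypothesis ch : forall i, convex_fun (h i).

(** Move only block i, from z_i towards y. As W is symmetric, the penalty has block gradient ((I -
    W) z)_i / a, and subtracting a times the total smooth gradient from z_i gives exactly the
    argument of the prox. First-order optimality is thus the variational inequality. *)
Lemma penalized_argmin_prox_vi a z i : 0 < a ->
  argmin (penalized_objective f h W a) z ->
  prox_vi a (h i) (dgd_point a i (fun j => row j z)) (row i z).
Proof.
move=> a0 [Gz minz].
have [r hr] : exists r : 'I_n -> R, forall k, h k (row k z) = (r k)%:E.
  apply: sep_sum_ext_lty => //; rewrite ltey; apply: contraPneq Gz => hz.
  by rewrite /penalized_objective hz.
exists (r i) => // y s hy.
set v := y - row i z.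
pose E : 'M[R]_(n, d) := \matrix_k (if k == i then v else 0).
pose A := 1%:M - W.
pose q := dot v (row i (A *m z)).
pose Q := dot E (A *m E).
have rowE k : row k E = if k == i then v else 0 by rewrite rowK.
have dotE (y' : 'M[R]_(n, d)) : dot E y' = dot v (row i y').
  rewrite dot_row (bigD1 i) //= rowE eqxx big1 ?addr0 // => k /negbTE ki.
  by rewrite rowE ki dot0l.
have quad t : dot (t *: E + z) (A *m (t *: E + z)) =
    dot z (A *m z) + 2 * t * q + t ^+ 2 * Q.
  have AT : A^T = A by rewrite /A linearB /= trmx1 symW.
  rewrite mulmxDr -scalemxAr !(dotDl, dotDr, dotZl, dotZr).
  rewrite -[in dot z (_ *m E)]AT -dot_mulmxl (dotC (_ *m z) E) !(dotE (A *m z)) -/q -/Q.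
  ring.
have fsum t : sep_sum f (t *: E + z) - sep_sum f z =
    f i (t *: v + row i z) - f i (row i z).
  rewrite /sep_sum -sumrB (bigD1 i) //= big1 ?addr0.
    by rewrite linearD linearZ /= rowE eqxx.
  move=> k /negbTE ki.
  by rewrite linearD linearZ /= rowE ki scaler0 add0r subrr.
have step t : 0 < t <= 1 ->
  0 <= f i (t *: v + row i z) - f i (row i z) + t * (s - r i) +
       (2 * a)^-1 * (2 * t * q + t ^+ 2 * Q).
  move=> /andP[t0 t1].
  have := @ch i y (row i z) t.
  rewrite (ltW t0) t1 hy hr -!EFinM -EFinD => /(_ isT).
  have -> : t *: y + (1 - t) *: row i z = t *: v + row i z.
    by rewrite /v scalerBr scalerBl scale1r -addrA [- _ + _]addrC.
  case hz: (h i _) => [c| |]; last 2 first.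
  - by rewrite leye_eq.
  - by have := @hNy i (t *: v + row i z); rewrite hz.
  rewrite lee_fin => hc.
  pose r' k := if k == i then c else r k.
  have hr' k : h k (row k (t *: E + z)) = (r' k)%:E.
    rewrite linearD linearZ /= rowE /r'; case: eqVneq => [->//|_].
    by rewrite scaler0 add0r.
  have := minz (t *: E + z).
  rewrite /penalized_objective (sep_sum_ext_fin hr) (sep_sum_ext_fin hr').
  rewrite -!EFinD lee_fin -/A quad.
  have -> : sep_sum f (t *: E + z) =
      sep_sum f z + (f i (t *: v + row i z) - f i (row i z)).
    by rewrite -fsum; ring.
  have -> : \sum_k r' k = \sum_k r k + (c - r i).
    rewrite (bigD1 i) //= [in RHS](bigD1 i) //= /r' eqxx.
    under eq_bigr => k /negbTE -> do [].
    by ring.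
  move: (dot z _) (sep_sum f z) (\sum_k r k) ((2 * a)^-1) => *; nra.
suff key : 0 <= dot (grad (f i) (row i z)) v + (s - r i) + a^-1 * q.
  have := ler_wpM2l (ltW a0) key; rewrite mulr0 !mulrDr mulVKf ?gt_eqF //.
  rewrite /dgd_point -row_mulmx /q /A mulmxBl mul1mx linearB -/v /=.
  rewrite (dotC v) !(dotDl (row i _)) !dotDl !dotNl dotZl; lra.
apply/ler_addgt0Pr => eps eps0.
have eps20 : 0 < eps / 2 by rewrite divr_gt0.
have [delta delta0 approx] := grad_first_order v (@df i (row i z)) eps20.
pose c := (2 * a)^-1 * `|Q|.
have c0 : 0 <= c by rewrite mulr_ge0 // invr_ge0 mulr_ge0 // ltW.
(* Per unit of t, the linearization error of f_i and the quadratic term Q each use up at most eps /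
   2. *)
pose t := Num.min (Num.min 1 (delta / 2)) (eps / 2 / (c + 1)).
have t0 : 0 < t by rewrite !lt_min ltr01 !divr_gt0 // ltr_pwDr.
have t1 : t <= 1 by rewrite !ge_min lexx.
have td : t < delta.
  by apply: (@le_lt_trans _ _ (delta / 2)); [rewrite !ge_min lexx orbT|lra].
have tc : t * (c + 1) <= eps / 2.
  by rewrite -ler_pdivlMr ?ltr_pwDr // ge_min lexx orbT.
have := approx t; rewrite t0 td => /(_ isT) /ler_normlP[_ ap].
have := step t; rewrite t0 t1 => /(_ isT).
have tQ : (2 * a)^-1 * (t * Q) <= eps / 2.
  apply: le_trans (_ : (2 * a)^-1 * (t * `|Q|) <= _).
    rewrite ler_wpM2l ?invr_ge0 ?mulr_ge0 ?(ltW a0) //.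
    by rewrite ler_wpM2l ?(ltW t0) // ler_norm.
  by rewrite mulrCA -/c; lra.
have -> : (2 * a)^-1 * (2 * t * q + t ^+ 2 * Q) =
    t * (a^-1 * q + (2 * a)^-1 * (t * Q)) by field; rewrite gt_eqF.
move=> st; rewrite -(ler_pM2l t0) mulr0.
have := ler_wpM2l (ltW t0) tQ.
lra.
Qed.

End FixedPoint.
(** * The update map *)

Section ProxDgdMap.
Variables (R : realType) (n d : nat) (W : 'M[R]_n).
Variables (f : 'I_n -> 'rV[R]_d -> R) (h : 'I_n -> 'rV[R]_d -> \bar R).
Variables (L : 'I_n -> R) (a : R).
Hypothesis W_ge0 : forall i j, 0 <= W i j.
Hypothesis W_diag : forall i, 0 < W i i.
Hypothesis W_row : forall i, \sum_j W i j = 1.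
Hypothesis hf : forall i, convex_fun (fun z => (f i z)%:E).
Hypothesis L_gt0 : forall i, 0 < L i.
Hypothesis hsmooth : forall i, smooth (L i) (f i).
Hypothesis hh : forall i, proper_closed_convex (h i).
Hypothesis hprox : forall i, exists u p, prox_vi a (h i) u p.
Hypothesis a_gt0 : 0 < a.
Hypothesis a_lt : forall i, a * L i < 2 * W i i.
Implicit Types (i j : 'I_n) (X Y : 'I_n -> 'rV[R]_d).

Let T i X := prox_dgd_map W f h a i X.

(** [hprox] provides one point at which the prox problem is solvable; [prox_vi_exists] carries
    solvability over to every point. *)
Lemma prox_dgd_map_vi i X : prox_vi a (h i) (dgd_point W f a i X) (T i X).
Proof.
have [u [p vi0]] := hprox i.
have [q vi] := prox_vi_exists (dgd_point W f a i X) a_gt0 (hh i) vi0.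
rewrite /T /prox_dgd_map (@prox_vi_prox _ _ _ _ _ _ q) //.
by have [[]] := hh i.
Qed.

(** The whole gradient step is charged to the node's own block: since w_ii gamma_i = a, the
    difference of two prox arguments is the w-weighted mean of the [gstep] vectors. The step-size
    condition becomes gamma_i L_i < 2, the usual one for a gradient step. *)
Let gamma i := a / W i i.
Let gstep i X Y j := X j - Y j -
  (if j == i then gamma i *: (grad (f i) (X i) - grad (f i) (Y i)) else 0).

Let gamma_gt0 i : 0 < gamma i. Proof. by rewrite divr_gt0. Qed.

Let gammaL_lt2 i : gamma i * L i < 2.
Proof. by rewrite mulrAC ltr_pdivrMr. Qed.

Let dgd_pointB i X Y :
  dgd_point W f a i X - dgd_point W f a i Y = \sum_j W i j *: gstep i X Y j.
Proof.
have -> : \sum_j W i j *: gstep i X Y j =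
    \sum_j W i j *: X j - \sum_j W i j *: Y j -
    W i i *: (gamma i *: (grad (f i) (X i) - grad (f i) (Y i))).
  have -> : W i i *: (gamma i *: (grad (f i) (X i) - grad (f i) (Y i))) =
      \sum_j W i j *: (if j == i then
         gamma i *: (grad (f i) (X i) - grad (f i) (Y i)) else 0).
    rewrite (bigD1 i) //= eqxx big1 ?addr0 // => j /negbTE ->.
    by rewrite scaler0.
  by rewrite -!sumrB; apply: eq_bigr => j _; rewrite !scalerBr.
rewrite scalerA /gamma mulrCA divff ?gt_eqF // mulr1 scalerBr.
by rewrite /dgd_point !opprB addrACA [RHS]addrACA [X in _ = _ + X]addrC.
Qed.

(* The gradient step is averaged by cocoercivity, the weighted mean by the
   variance identity and prox by firm nonexpansiveness. *)
Let map_ineq i X Y (u := dgd_point W f a i X - dgd_point W f a i Y)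
    (p := T i X - T i Y) :
  dot p p + dot (u - p) (u - p) +
    \sum_j W i j * dot (gstep i X Y j - u) (gstep i X Y j - u) <=
  \sum_j W i j * dot (gstep i X Y j) (gstep i X Y j).
Proof.
rewrite -(dot_weighted_mean (gstep i X Y) (W_row i)) -dgd_pointB -/u lerD2r.
exact: (prox_vi_firm (prox_dgd_map_vi i X) (prox_dgd_map_vi i Y)).
Qed.

Let gstep_sqr i X Y (g := grad (f i) (X i) - grad (f i) (Y i)) :
  dot (gstep i X Y i) (gstep i X Y i) =
  dot (X i - Y i) (X i - Y i) - 2 * gamma i * dot g (X i - Y i) +
  gamma i ^+ 2 * dot g g.
Proof.
rewrite /gstep eqxx -/g; move: (X i - Y i) g => y g'.
by rewrite !(dotDl, dotDr, dotNl, dotNr, dotZl, dotZr) (dotC y g'); ring.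
Qed.

(** The constant is the one for which expanding the square leaves exactly cocoercivity; it is
    positive because gamma_i L_i < 2. Blocks j other than i do not move. *)
Let gstep_averaged i X Y j :
  dot (gstep i X Y j) (gstep i X Y j) + (2 / (gamma i * L i) - 1) *
    dot (X j - Y j - gstep i X Y j) (X j - Y j - gstep i X Y j) <=
  dot (X j - Y j) (X j - Y j).
Proof.
have -> : X j - Y j - gstep i X Y j = if j == i then
    gamma i *: (grad (f i) (X i) - grad (f i) (Y i)) else 0.
  by rewrite /gstep opprB addrC subrK.
case: eqVneq => [->|ji]; last first.
  by rewrite /gstep (negbTE ji) subr0 dot0l mulr0 addr0.
rewrite gstep_sqr dotZl dotZr.
have := cocoercive (Y i) (X i) (L_gt0 i) (hf i) (hsmooth i).
set g := dot (_ - _) (_ - _); set gy := dot (_ - _) (X i - Y i) => coco.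
have -> : (2 / (gamma i * L i) - 1) * (gamma i * (gamma i * g)) =
    2 * gamma i * (g / L i) - gamma i ^+ 2 * g.
  by field; rewrite !gt_eqF.
have : g / L i <= gy by rewrite ler_pdivrMr // mulrC.
move/(ler_wpM2l (ltW (gamma_gt0 i))); lra.
Qed.

Lemma prox_dgd_map_averaged i : exists2 kappa, 0 < kappa & forall X Y,
  dot (T i X - T i Y) (T i X - T i Y) + kappa *
    \sum_j W i j * dot (X j - Y j - (T i X - T i Y)) (X j - Y j - (T i X - T i Y))
  <= \sum_j W i j * dot (X j - Y j) (X j - Y j).
Proof.
pose c := 2 / (gamma i * L i) - 1.
have gL : 0 < gamma i * L i := mulr_gt0 (gamma_gt0 i) (L_gt0 i).
have c0 : 0 < c by rewrite subr_gt0 ltr_pdivlMr // mul1r; exact: gammaL_lt2.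
(* X_j - Y_j - p is a sum of three deviations: gradient step, spread about the mean, prox residual.
   Squaring costs a factor 3, and the slacks available for them have coefficients c, 1 and 1. *)
pose k := Num.min c 1 / 3.
have k0 : 0 < k by rewrite divr_gt0 // lt_min c0 ltr01.
have kc : 3 * k <= c by rewrite mulrC divfK // ge_min lexx.
have k1 : 3 * k <= 1 by rewrite mulrC divfK // ge_min lexx orbT.
exists k => // X Y; have /= := map_ineq i X Y.
set u := dgd_point _ _ _ _ _ - _; set p := T i X - T i Y => main.
have split_sum : \sum_j W i j * dot (X j - Y j - p) (X j - Y j - p) <=
    3 * (\sum_j W i j * dot (X j - Y j - gstep i X Y j) (X j - Y j - gstep i X Y j)
    + \sum_j W i j * dot (gstep i X Y j - u) (gstep i X Y j - u)
    + dot (u - p) (u - p)).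
  have -> : dot (u - p) (u - p) = \sum_j W i j * dot (u - p) (u - p).
    by rewrite -mulr_suml W_row mul1r.
  rewrite -!big_split mulr_sumr; apply: ler_sum => j _ /=.
  rewrite -!mulrDr mulrCA ler_wpM2l //.
  have -> : X j - Y j - p = (X j - Y j - gstep i X Y j) + (gstep i X Y j - u)
      + (u - p) by rewrite !subrKA.
  move: (_ - gstep _ _ _ _) (_ - u) (u - p) => b1 b2 b3.
  have := dot_ge0 (b1 - b2); have := dot_ge0 (b2 - b3); have := dot_ge0 (b1 - b3).
  rewrite !(dotDl, dotDr, dotNl, dotNr) (dotC b2 b1) (dotC b3 b1) (dotC b3 b2).
  lra.
have avg : \sum_j W i j * dot (gstep i X Y j) (gstep i X Y j) + c *
    \sum_j W i j * dot (X j - Y j - gstep i X Y j) (X j - Y j - gstep i X Y j) <=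
    \sum_j W i j * dot (X j - Y j) (X j - Y j).
  rewrite mulr_sumr -big_split; apply: ler_sum => j _ /=.
  by rewrite mulrCA -mulrDr ler_wpM2l // gstep_averaged.
have s1 : 0 <= \sum_j W i j *
    dot (X j - Y j - gstep i X Y j) (X j - Y j - gstep i X Y j).
  by apply: sumr_ge0 => j _; rewrite mulr_ge0 ?dot_ge0.
have s2 : 0 <= \sum_j W i j * dot (gstep i X Y j - u) (gstep i X Y j - u).
  by apply: sumr_ge0 => j _; rewrite mulr_ge0 ?dot_ge0.
have s3 := dot_ge0 (u - p).
have := ler_wpM2l (ltW k0) split_sum.
have := ler_wpM2r s1 kc; have := ler_wpM2r s2 k1; have := ler_wpM2r s3 k1.
lra.
Qed.

(** Strong convexity shrinks only the node's own block, by 1 - gamma_i mu (2 - gamma_i L_i).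
    Averaging with weight w_ii against unshrunk blocks turns gamma_i into a in this factor. *)
Lemma prox_dgd_map_contracts i (mu rho M : R) X Y :
  strongly_convex mu (f i) -> 0 < mu ->
  1 - a * (mu * (2 - a * L i / W i i)) <= rho ^+ 2 ->
  (forall j, dot (X j - Y j) (X j - Y j) <= M) ->
  dot (T i X - T i Y) (T i X - T i Y) <= rho ^+ 2 * M.
Proof.
move=> [_ sc] mu0 hrho XYM.
have M0 : 0 <= M := le_trans (dot_ge0 _) (XYM i).
have {}sc x y : mu * dot (y - x) (y - x) <=
    dot (grad (f i) y - grad (f i) x) (y - x) by rewrite -sqr_enorm.
(* A nonzero vector is required to derive mu <= L_i; for d = 0 there is none and the claim is
   trivial. *)
case: (pselect (exists z : 'rV[R]_d, 0 < dot z z)) => [[z z0]|nz]; last first.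
  suff -> : dot (T i X - T i Y) (T i X - T i Y) = 0 by rewrite mulr_ge0 ?sqr_ge0.
  apply/eqP; rewrite eq_le dot_ge0 andbT leNgt; apply/negP => p0.
  by apply: nz; exists (T i X - T i Y).
have muL : mu <= L i.
  have := sc 0 z; rewrite subr0.
  have := cocoercive 0 z (L_gt0 i) (hf i) (hsmooth i); rewrite subr0.
  move: (grad _ _ - _) => g coco h1.
  have := dot_young z g (L_gt0 i); rewrite (dotC z g) => h2.
  have h3 : (L i)^-1 * dot g g <= dot g z by rewrite ler_pdivrMl.
  rewrite -(ler_pM2r z0); lra.
set c := mu * (2 - gamma i * L i).
have c_ge0 : 0 <= c by rewrite mulr_ge0 ?ltW // subr_gt0.
(* Replacing mu by L_i bounds this from below by the square (1 - gamma_i L_i)^2. *)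
have gc1 : 0 <= 1 - gamma i * c.
  have := gammaL_lt2 i; have := gamma_gt0 i.
  rewrite /c; have := L_gt0 i; move: (gamma i) (L i) muL => g l.
  move=> muL l0 g0 gl.
  have : g * (mu * (2 - g * l)) <= g * (l * (2 - g * l)).
    by rewrite ler_wpM2l ?(ltW g0) // ler_wpM2r // subr_ge0 ltW.
  have := sqr_ge0 (1 - g * l); lra.
have vi : dot (gstep i X Y i) (gstep i X Y i) <= (1 - gamma i * c) * M.
  apply: le_trans (ler_wpM2l gc1 (XYM i)).
  rewrite gstep_sqr.
  have := cocoercive (Y i) (X i) (L_gt0 i) (hf i) (hsmooth i).
  have := sc (Y i) (X i).
  set g := dot (_ - _) (grad _ _ - _); set gy := dot (_ - _) (X i - Y i).
  set y := dot _ _ => s1 s2.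
  have e1 := ler_wpM2l (sqr_ge0 (gamma i)) s2.
  have e2 : 0 <= gamma i * (2 - gamma i * L i).
    by rewrite mulr_ge0 ?ltW // subr_gt0.
  have e3 := ler_wpM2l e2 s1.
  rewrite /c; move: e1 e3; lra.
have j_le : forall j, j != i -> dot (gstep i X Y j) (gstep i X Y j) <= M.
  by move=> j ji; rewrite /gstep (negbTE ji) subr0.
apply: (@le_trans _ _ (\sum_j W i j * dot (gstep i X Y j) (gstep i X Y j))).
  apply: le_trans (map_ineq i X Y).
  rewrite -addrA lerDl addr_ge0 ?dot_ge0 //.
  by apply: sumr_ge0 => j _; rewrite mulr_ge0 ?dot_ge0.
apply: (@le_trans _ _ (W i i * ((1 - gamma i * c) * M) + (1 - W i i) * M)).
  rewrite (bigD1 i) //=; apply: lerD; first by rewrite ler_wpM2l.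
  have -> : 1 - W i i = \sum_(j | j != i) W i j.
    by have := W_row i; rewrite (bigD1 i) //=; lra.
  by rewrite mulr_suml; apply: ler_sum => j ji; rewrite ler_wpM2l // j_le.
have -> : W i i * ((1 - gamma i * c) * M) + (1 - W i i) * M =
    (1 - a * (mu * (2 - a * L i / W i i))) * M.
  by rewrite /c /gamma; field; rewrite gt_eqF.
by rewrite ler_wpM2r.
Qed.

End ProxDgdMap.

(** * Partially asynchronous iterations *)

Section Asynchronous.
Variables (R : realType) (n d : nat) (e : rel 'I_n) (w : 'I_n -> 'I_n -> R).
Variable T : 'I_n -> ('I_n -> 'rV[R]_d) -> 'rV[R]_d.
Variables (K : 'I_n -> set nat) (tau : 'I_n -> 'I_n -> nat -> nat) (B D : nat).
Variable z : nat -> 'I_n -> 'rV[R]_d.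
Hypothesis w_ge0 : forall i j, 0 <= w i j.
Hypothesis w_row : forall i, \sum_j w i j = 1.
Hypothesis activeP : forall i k, exists2 l, (k <= l <= k + B)%N & K i l.
Hypothesis tau_bound : forall i j k, (k - D <= tau i j k <= k)%N.
Hypothesis z_active : forall i k, K i k ->
  z k.+1 i = T i (fun j => z (tau i j k) j).
Hypothesis z_idle : forall i k, ~ K i k -> z k.+1 i = z k i.
Implicit Types (i j : 'I_n) (k l t : nat) (y : 'I_n -> 'rV[R]_d).

(** The iterates at times k - D to k are the state of the delayed system: later updates read nothing
    older, so strong induction on t applies. *)
Lemma async_bound_persists y k c :
  (forall i k' M,
     (forall j, dot (z (tau i j k') j - y j) (z (tau i j k') j - y j) <= M) ->
     dot (T i (fun j => z (tau i j k') j) - y i)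
         (T i (fun j => z (tau i j k') j) - y i) <= M) ->
  (forall t i, (k - D <= t <= k)%N -> dot (z t i - y i) (z t i - y i) <= c) ->
  forall t i, (k - D <= t)%N -> dot (z t i - y i) (z t i - y i) <= c.
Proof.
move=> Tc base; elim/ltn_ind => t IH i kt.
case: (leqP t k) => tk; first by apply: base; rewrite kt.
case: t tk kt IH => // t tk kt IH.
case: (pselect (K i t)) => [Ki|nKi]; last by rewrite z_idle //; apply: IH => //; lia.
by rewrite z_active //; apply: Tc => j; apply: IH; have := tau_bound i j t; lia.
Qed.

Lemma async_rate y (q c : R) : q <= 1 -> 0 <= q ->
  (forall i X M, (forall j, dot (X j - y j) (X j - y j) <= M) ->
     dot (T i X - y i) (T i X - y i) <= q * M) ->
  (forall i, dot (z 0%N i - y i) (z 0%N i - y i) <= c) ->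
  forall m t i, (m * (B + D + 1) <= t)%N ->
    dot (z t i - y i) (z t i - y i) <= q ^+ m * c.
Proof.
move=> q1 q0 Tq base; elim=> [|m IH] t i mt.
  rewrite expr0 mul1r; apply: (@async_bound_persists y 0) => //.
    move=> j k M /[dup] /(_ j) /(le_trans (dot_ge0 _)) M0 /Tq /le_trans; apply.
    by rewrite ler_piMl.
  by move=> k j; rewrite leqn0 => /andP[_ /eqP ->].
(* From [N] on, every version read already satisfies the level-m bound. Each node is active by time
   N + B, with its result in place by N + B + 1, the start of round m + 1. *)
pose N := (m * (B + D + 1) + D)%N.
have act l : (N <= l)%N -> K i l ->
    dot (z l.+1 i - y i) (z l.+1 i - y i) <= q ^+ m.+1 * c.
  move=> Nl Kl; rewrite z_active // exprS -mulrA; apply: Tq => j; apply: IH.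
  by have := tau_bound i j l; rewrite /N in Nl; lia.
have [l Nl Kl] := activeP i N.
have lt : (l.+1 <= t)%N by rewrite /N in Nl; lia.
rewrite -(subnK lt); elim: (t - l.+1)%N => [|r IHr]; first by apply: act => //; lia.
rewrite addSn; case: (pselect (K i (r + l.+1)%N)) => [Ki|nKi].
  by apply: act => //; lia.
by rewrite z_idle.
Qed.

Hypothesis w_nbhd : forall i j, closed_nbhd e i j -> 0 < w i j.
Hypothesis econn : forall i j, connect e i j.
Hypothesis tau_diag : forall i k, tau i i k = k.
Variable kappa : 'I_n -> R.
Hypothesis kappa_gt0 : forall i, 0 < kappa i.
Hypothesis T_averaged : forall i X Y,
  dot (T i X - T i Y) (T i X - T i Y) + kappa i *
    \sum_j w i j * dot (X j - Y j - (T i X - T i Y)) (X j - Y j - (T i X - T i Y))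
  <= \sum_j w i j * dot (X j - Y j) (X j - Y j).

Let mean_le i (F : 'I_n -> R) M : (forall j, F j <= M) -> \sum_j w i j * F j <= M.
Proof.
move=> FM; rewrite -[leRHS]mul1r -(w_row i) mulr_suml.
by apply: ler_sum => j _; rewrite ler_wpM2l.
Qed.

Let T_nonexpansive i X Y M : (forall j, dot (X j - Y j) (X j - Y j) <= M) ->
  dot (T i X - T i Y) (T i X - T i Y) <= M.
Proof.
move=> XY; have := T_averaged i X Y.
have : 0 <= kappa i * \sum_j w i j *
    dot (X j - Y j - (T i X - T i Y)) (X j - Y j - (T i X - T i Y)).
  apply: mulr_ge0; first exact: ltW.
  by apply: sumr_ge0 => j _; rewrite mulr_ge0 ?dot_ge0.
have := mean_le i XY; lra.
Qed.

(** * Errors relative to a fixed point *)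

Section Reference.
Variable y : 'I_n -> 'rV[R]_d.
Hypothesis Ty : forall i, T i y = y i.

Let Delta t i := z t i - y i.
Let sq (v : 'rV[R]_d) := dot v v.

Lemma async_persists k c :
  (forall t i, (k - D <= t <= k)%N -> dot (z t i - y i) (z t i - y i) <= c) ->
  forall t i, (k - D <= t)%N -> dot (z t i - y i) (z t i - y i) <= c.
Proof.
by apply: async_bound_persists => i k' M XM; rewrite -Ty; exact: T_nonexpansive.
Qed.

(* If the error of an active node stays within eps of the asymptotic maximum V,
   equality almost holds in the strictly convex estimate, so the errors it has
   averaged are all close to V in norm and to one another. *)
Lemma async_step_rigidity : exists2 C, 1 <= C & forall i k (V eps : R), 0 <= eps ->
  K i k -> (forall j, sq (Delta (tau i j k) j) <= V + eps) ->
  V - eps <= sq (Delta k.+1 i) -> forall j, closed_nbhd e i j ->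
  V - C * eps <= sq (Delta (tau i j k) j) /\
  sq (Delta (tau i j k) j - Delta k.+1 i) <= C * eps.
Proof.
(* One summand serves for the spread, the other for the norm deficit; summing over all pairs makes C
   uniform. *)
pose c i j := 2 / (kappa i * w i j) + 2 / w i j.
have c_ge0 i j : 0 <= c i j.
  by rewrite addr_ge0 // divr_ge0 // mulr_ge0 // ltW.
exists (1 + \sum_i \sum_j c i j) => [|i k V eps eps0 Ki up lo j eij].
  by rewrite lerDl; apply: sumr_ge0 => i _; apply: sumr_ge0 => j _.
have := T_averaged i (fun j => z (tau i j k) j) y.
rewrite Ty -z_active // -/(Delta k.+1 i) -/(sq (Delta k.+1 i)) => main.
have wij := w_nbhd eij.
have cC : c i j <= 1 + \sum_i \sum_j c i j.
  have r1 : c i j <= \sum_j c i j.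
    by rewrite [leRHS](bigD1 j) //= lerDl sumr_ge0.
  have r2 : \sum_j c i j <= \sum_i \sum_j c i j.
    rewrite [leRHS](bigD1 i) //= lerDl sumr_ge0 // => i' _.
    by apply: sumr_ge0 => j' _.
  by apply: le_trans r1 (le_trans r2 _); rewrite lerDr.
(* Two sums of nonnegative terms share a budget of 2 eps, so each single term is at most 2 eps. *)
have slack : \sum_j w i j * (V + eps - sq (Delta (tau i j k) j)) +
    kappa i * \sum_j w i j * sq (Delta (tau i j k) j - Delta k.+1 i) <= 2 * eps.
  have -> : \sum_j w i j * (V + eps - sq (Delta (tau i j k) j)) =
      V + eps - \sum_j w i j * sq (Delta (tau i j k) j).
    under eq_bigr do rewrite mulrBr.
    by rewrite sumrB -mulr_suml w_row mul1r.
  move: main lo; rewrite /sq /Delta; lra.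
have s1 j' : 0 <= w i j' * (V + eps - sq (Delta (tau i j' k) j')).
  by rewrite mulr_ge0 // subr_ge0.
have s2 j' : 0 <= w i j' * sq (Delta (tau i j' k) j' - Delta k.+1 i).
  by rewrite mulr_ge0 // dot_ge0.
have S1 : 0 <= \sum_j w i j * (V + eps - sq (Delta (tau i j k) j)).
  exact: sumr_ge0.
have S2 : 0 <= \sum_j w i j * sq (Delta (tau i j k) j - Delta k.+1 i).
  exact: sumr_ge0.
have t1 : w i j * (V + eps - sq (Delta (tau i j k) j)) <= 2 * eps.
  apply: le_trans (_ : \sum_j w i j * (V + eps - sq (Delta (tau i j k) j)) <= _).
    by rewrite [leRHS](bigD1 j) //= lerDl sumr_ge0.
  by apply: le_trans slack; rewrite lerDl mulr_ge0 // ltW.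
have t2 : kappa i * w i j * sq (Delta (tau i j k) j - Delta k.+1 i) <= 2 * eps.
  apply: le_trans
    (_ : kappa i * \sum_j w i j * sq (Delta (tau i j k) j - Delta k.+1 i) <= _).
    by rewrite -mulrA ler_pM2l // [leRHS](bigD1 j) //= lerDl sumr_ge0.
  by apply: le_trans slack; rewrite lerDr.
have cCe := ler_wpM2r eps0 cC.
have kw : 0 < kappa i * w i j by rewrite mulr_gt0.
have d1 : 0 <= 2 / (kappa i * w i j) * eps by rewrite mulr_ge0 // divr_ge0 // ltW.
have d2 : 0 <= 2 / w i j * eps by rewrite mulr_ge0 // divr_ge0 // ltW.
rewrite /c mulrDl in cCe.
split.
- have : V + eps - sq (Delta (tau i j k) j) <= 2 / w i j * eps.
    by rewrite mulrAC ler_pdivlMr // mulrC.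
  lra.
- have : sq (Delta (tau i j k) j - Delta k.+1 i) <= 2 / (kappa i * w i j) * eps.
    by rewrite mulrAC ler_pdivlMr // mulrC.
  lra.
Qed.

Let c0 := \sum_i sq (Delta 0 i).

Let Delta_le t i : sq (Delta t i) <= c0.
Proof.
apply: (@async_persists 0) => // t' i'; rewrite leqn0 => /andP[_ /eqP ->].
by rewrite /c0 (bigD1 i') //= lerDl; apply: sumr_ge0 => j _; exact: dot_ge0.
Qed.

(** V is the infimum of the eventual upper bounds. Were a whole window of D + 1 iterates below V -
    eps, persistence would make V - eps an eventual bound; hence every window contains a nearly
    maximal error. *)
Lemma async_limsup i0 : exists V : R, forall eps, 0 < eps ->
  (exists N, forall t i, (N <= t)%N -> sq (Delta t i) <= V + eps) /\
  (forall k, exists t i, (k - D <= t <= k)%N /\ V - eps <= sq (Delta t i)).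
Proof.
pose S := [set c : R | exists N, forall t i, (N <= t)%N -> sq (Delta t i) <= c].
have S_inf : has_inf S.
  split; first by exists c0, 0%N => t i _; exact: Delta_le.
  exists 0 => c [N /(_ N i0 (leqnn N))]; apply: le_trans; exact: dot_ge0.
exists (inf S) => eps eps0; split.
  have [c [N hN] cS] := inf_adherent eps0 S_inf.
  by exists N => t i /hN /le_trans; apply; exact: ltW.
move=> k; apply: contrapT => none.
have : inf S <= inf S - eps.
  apply: ge_inf; first exact: S_inf.2.
  exists (k - D)%N; apply: async_persists => t i kt.
  rewrite leNgt; apply/negP => /ltW h; apply: none.
  by exists t, i.
by rewrite lerDl oppr_ge0 leNgt eps0.
Qed.

Lemma async_consensus_window (i0 : 'I_n) (delta : R) (r : nat) : 0 < delta ->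
  exists N, forall k, (N <= k)%N -> exists v : 'rV[R]_d,
    forall t i, (k <= t <= k + r)%N -> sq (Delta t i - v) <= delta.
Proof.
move=> delta0.
have [V limV] := async_limsup i0.
have [C C1 rigid] := async_step_rigidity.
pose A := 4 * C.
have A1 : 1 <= A by rewrite /A; lra.
have A0 : 0 < A := lt_le_trans ltr01 A1.
(* [H] is the time lost per edge. [S] covers n edges, the r steps wanted, and the D steps by which
   t0 may precede k + S. [M] counts backward steps: S at the starting node, then one hop and at most
   S more for each edge. It does not depend on k, so [eps] can be fixed in advance. *)
pose H := (B + D + 1)%N.
pose S := (n * H + r + D)%N.
pose M := (S + n * S.+1)%N.
pose eps := delta / A ^+ M.
have eps0 : 0 < eps by rewrite divr_gt0 // exprn_gt0.
have [[N hN] start] := limV eps eps0.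
exists (N + D)%N => k Nk.
have [t0 [i1 [t0k t0V]]] := start (k + S)%N.
exists (Delta t0 i1).
(* Holds of every (t, i) reached from (t0, i1) by m backward steps; the factor
   4 * C pays for async_step_rigidity and for dot_youngD at each step. *)
pose good m t i := V - A ^+ m * eps <= sq (Delta t i) /\
  sq (Delta t i - Delta t0 i1) <= A ^+ m * eps.
have Apow m m' : (m <= m')%N -> A ^+ m * eps <= A ^+ m' * eps.
  by move=> mm'; rewrite ler_pM2r // ler_weXn2l.
have good_mono m m' t i : (m <= m')%N -> good m t i -> good m' t i.
  by move=> /Apow mm' [g1 g2]; split; lra.
have Ae0 m : 0 <= A ^+ m * eps by rewrite ltW // mulr_gt0 // exprn_gt0.
have good0 : good 0%N t0 i1.
  by split; rewrite expr0 mul1r // /sq subrr dot0l ltW.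
have hop m t i j : (k <= t)%N -> K i t -> closed_nbhd e i j ->
    good m t.+1 i -> good m.+1 (tau i j t) j.
  move=> kt Ki eij [g1 g2].
  have up j' : sq (Delta (tau i j' t) j') <= V + A ^+ m * eps.
    apply: le_trans (_ : V + eps <= _); last first.
      by rewrite lerD2l; have := Apow 0%N m (leq0n m); rewrite mul1r.
    by apply: hN; have := tau_bound i j' t; lia.
  have [h1 h2] := rigid i t V _ (Ae0 m) Ki up g1 j eij.
  have A4 : A ^+ m.+1 * eps = 4 * (C * (A ^+ m * eps)) by rewrite exprS /A; ring.
  have C0 : A ^+ m * eps <= C * (A ^+ m * eps) by rewrite ler_peMl.
  split; rewrite A4; first by have := Ae0 m; lra.
  have -> : Delta (tau i j t) j - Delta t0 i1 =
    (Delta (tau i j t) j - Delta t.+1 i) + (Delta t.+1 i - Delta t0 i1).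
    by rewrite subrKA.
  apply: le_trans (dot_youngD _ _) _; move: h2 g2; rewrite /sq; lra.
(* An active node averages its own current value with positive weight, so the hop applies with j =
   i; an idle node keeps its error. *)
have back1 m t i : (k <= t)%N -> good m t.+1 i -> good m.+1 t i.
  move=> kt g; case: (pselect (K i t)) => [Ki|nKi].
    by rewrite -(tau_diag i t); apply: hop g => //; rewrite /closed_nbhd eqxx.
  have Di : Delta t.+1 i = Delta t i by rewrite /Delta z_idle.
  by move: g; rewrite /good Di; exact: good_mono.
have back m t t' i : (k <= t' <= t)%N -> good m t i -> good (m + (t - t'))%N t' i.
  move=> /andP[kt' tt']; rewrite -{1}(subnK tt').
  elim: (t - t')%N m => [|u IH] m; first by rewrite addn0.
  rewrite addSn => /(back1 _ _ _ (leq_trans kt' (leq_addl _ _))) /IH.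
  by rewrite addSnnS.
(* Some activation of i at l in [u - B - 1, u - 1] reads a version of j no older than u - H. That
   version is good, and [back] extends this to all times of j down to k. *)
have spread p : forall i m u, path e i p -> (k + size p * H <= u <= k + S)%N ->
    (forall t, (k <= t <= u)%N -> good m t i) ->
    forall t, (k <= t <= u - size p * H)%N ->
      good (m + size p * S.+1)%N t (last i p).
  elim: p => [|j p IH] i m u /=; first by move=> _ _; rewrite !mul0n addn0 subn0.
  move=> /andP[eij pp] ku gi t kt.
  have [l lu Kl] := activeP i (u - B.+1)%N.
  have gj : forall t', (k <= t' <= u - H)%N -> good (m + S.+1)%N t' j.
    move=> t' t'u.
    have gl : good m l.+1 i by apply: gi; rewrite /H in ku t'u; lia.
    have kl : (k <= l)%N by rewrite /H in ku t'u; lia.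
    have nij : closed_nbhd e i j by rewrite /closed_nbhd eij orbT.
    have gtau := hop _ _ _ _ kl Kl nij gl.
    have tb := tau_bound i j l.
    have kt' : (k <= t' <= tau i j l)%N by rewrite /H in ku t'u; lia.
    by apply: good_mono (back _ _ _ _ kt' gtau); rewrite /H in ku t'u; lia.
  have -> : (m + (size p).+1 * S.+1 = m + S.+1 + size p * S.+1)%N by lia.
  by apply: (IH j _ (u - H)%N) => //; lia.
move=> t i tr; have /connectP[p0 p0P ->] := econn i1 i.
case: (shortenP p0P) => p pp up _.
have pn : (size p <= n)%N.
  by have := max_card (mem (i1 :: p)); rewrite (card_uniqP up) card_ord => /ltnW.
have pH : (size p * H <= n * H)%N by rewrite leq_mul2r pn orbT.
have from_i1 t' : (k <= t' <= t0)%N -> good S t' i1.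
  move=> t'0; apply: good_mono (back _ _ _ _ t'0 good0).
  by rewrite /S in t0k *; lia.
have [] := spread p i1 S t0 pp _ from_i1 t.
- by move: t0k; rewrite /S; move: (n * H)%N (size p * H)%N pH => u u' uu'; lia.
- by move: t0k; rewrite /S; move: (n * H)%N (size p * H)%N pH => u u' uu'; lia.
move=> _ /le_trans; apply.
have pM : (S + size p * S.+1 <= M)%N by rewrite leq_add2l leq_mul2r pn orbT.
apply: le_trans (Apow _ _ pM) _.
by rewrite /eps mulrC divfK // expf_neq0 // gt_eqF.
Qed.

End Reference.

Lemma async_converges (i0 : 'I_n) : (exists y, forall i, T i y = y i) ->
  exists2 y, forall i, T i y = y i & forall eps : R, 0 < eps ->
    exists N, forall t i, (N <= t)%N -> dot (z t i - y i) (z t i - y i) <= eps.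
Proof.
move=> [y0 Ty0].
pose X t := \matrix_i (z t i - y0 i).
have rowX t i : row i (X t) = z t i - y0 i by rewrite rowK.
have [Y accY] : exists Y, forall (eps : R) (N : nat), 0 < eps ->
    exists2 k, (N <= k)%N & dot (X k - Y) (X k - Y) <= eps.
  pose c := \sum_i dot (z 0%N i - y0 i) (z 0%N i - y0 i).
  apply: (@bounded_seq_accumulation _ _ _ _ (\sum_(i < n) c)) => k.
  rewrite dot_row; apply: ler_sum => i _; rewrite rowX.
  apply: (@async_persists y0 Ty0 0) => // t' i'; rewrite leqn0 => /andP[_ /eqP ->].
  by rewrite /c (bigD1 i') //= lerDl; apply: sumr_ge0 => j _; exact: dot_ge0.
pose y i := row i Y + y0 i.
have window (eps : R) (N : nat) : 0 < eps -> exists2 k, (N <= k)%N &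
    forall t i, (k - D <= t <= k + B.+1)%N -> dot (z t i - y i) (z t i - y i) <= eps.
  move=> eps0.
  (* Two uses of [dot_youngD] weight the three pieces by 4, 4 and 2. *)
  have delta0 : 0 < eps / 10 by rewrite divr_gt0.
  (* The D steps before k hold the versions that updates read; the B + 1 steps after k contain an
     activation of every node together with its result. *)
  have [N' cons] := async_consensus_window Ty0 i0 (D + B.+1)%N delta0.
  have [k Nk kY] := accY _ (N + N' + D)%N delta0.
  exists k => [|t i tk]; first by lia.
  have [v hv] := cons (k - D)%N ltac:(lia).
  have h1 := hv t i ltac:(lia); have h2 := hv k i ltac:(lia).
  have h3 : dot (z k i - y i) (z k i - y i) <= eps / 10.
    have -> : z k i - y i = row i (X k - Y).
      by rewrite linearB /= rowX /y opprD addrA addrAC.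
    apply: le_trans kY; rewrite [leRHS]dot_row (bigD1 i) //=.
    by rewrite lerDl; apply: sumr_ge0 => j _; exact: dot_ge0.
  have -> : z t i - y i = ((z t i - y0 i - v) + (v - (z k i - y0 i))) + (z k i - y i).
    by rewrite subrKA opprB !subrKA.
  apply: le_trans (dot_youngD _ _) _.
  have := dot_youngD (z t i - y0 i - v) (v - (z k i - y0 i)).
  rewrite -[in X in _ <= _ + 2 * X](opprB _ v) dotNl dotNr opprK.
  lra.
have Ty i : T i y = y i.
  apply/eqP; rewrite -subr_eq0; apply/eqP/dot_eq0/ler_addgt0Pr => eps eps0.
  have eps40 : 0 < eps / 4 by rewrite divr_gt0.
  have [k _ kw] := window _ 0%N eps40.
  have [l lk Kl] := activeP i k.
  have h1 := kw l.+1 i ltac:(lia).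
  have h2 : dot (z l.+1 i - T i y) (z l.+1 i - T i y) <= eps / 4.
    rewrite z_active //; apply: T_nonexpansive => j.
    by apply: kw; have := tau_bound i j l; lia.
  rewrite -(opprB _ (T i y)) dotNl dotNr opprK.
  have -> : y i - T i y = (y i - z l.+1 i) + (z l.+1 i - T i y) by rewrite subrKA.
  apply: le_trans (dot_youngD _ _) _.
  rewrite -(opprB _ (y i)) dotNl dotNr opprK; lra.
exists y => // eps eps0.
have [k _ kw] := window _ 0%N eps0.
(* Now that y is itself a fixed point, one window close to y keeps all later iterates close. *)
exists (k - D)%N; apply: async_persists => // t i tk.
by apply: kw; lia.
Qed.

End Asynchronous.
(** * Convergence and rate *)

Section MinOrd.
Variables (R : realType) (n : nat) (F : 'I_n.+1 -> R).

Lemma min_ord_le i : min_ord F <= F i.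
Proof. exact: bigmin_le. Qed.

Lemma le_min_ord c : (forall i, c <= F i) -> c <= min_ord F.
Proof. by move=> cF; exact: le_bigmin. Qed.

End MinOrd.

(** For negative q the root is 0 by convention, so the sign of the radicand in rho need not be
    discussed. *)
Lemma le_sqr_sqrt (R : realType) (q : R) : q <= Num.sqrt q ^+ 2.
Proof.
case: (leP 0 q) => [q0|/ltW q0]; first by rewrite sqr_sqrtr.
by apply: le_trans q0 _; exact: sqr_ge0.
Qed.

(** Passes from Euclidean block errors to the topology of matrices, which is that of the sup
    norm. *)
Lemma cvg_rows (R : realType) (n d : nat) (x : nat -> 'M[R]_(n, d)) y :
  (forall eps, 0 < eps -> exists N, forall k i, (N <= k)%N ->
     dot (row i (x k - y)) (row i (x k - y)) <= eps) ->
  x k @[k --> \oo] --> y.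
Proof.
move=> xy; apply/cvgrPdist_le => eps eps0.
have [N hN] := xy (eps ^+ 2) (exprn_gt0 _ eps0).
exists N => // k /= Nk.
rewrite [leLHS]/Num.norm /= mx_normrE.
apply/bigmax_leP => /=; split=> [|[i j] _ /=]; first exact: ltW.
rewrite -ler_sqr ?nnegrE ?(ltW eps0) // real_normK ?num_real //.
apply: le_trans (hN k i Nk); apply: le_trans (sqr_entry_le_dot _ 0 j).
by rewrite !mxE -opprB sqrrN.
Qed.

Theorem theorem2 (R : realType) (n d : nat) (e : rel 'I_n.+1)
    (W : 'M[R]_n.+1)
    (f : 'I_n.+1 -> 'rV[R]_d -> R) (h : 'I_n.+1 -> 'rV[R]_d -> \bar R)
    (L : 'I_n.+1 -> R) (alpha : R)
    (K : 'I_n.+1 -> set nat) (s : 'I_n.+1 -> 'I_n.+1 -> nat -> nat)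
    (B D : nat) (x : nat -> 'M[R]_(n.+1, d))
    (hgraph : connected_graph e)
    (hW : averaging_matrix e W)
    (hf : forall i, proper_closed_convex (fun z => (f i z)%:E))
    (hh : forall i, proper_closed_convex (h i))
    (hL : forall i, 0 < L i)
    (hsmooth : forall i, smooth (L i) (f i))
    (hbounded : forall i, exists c : R, forall z,
       (c%:E <= (f i z)%:E + h i z)%E)
    (hsol : argmin (consensus_objective f h) !=set0)
    (hmin : forall a : R, 0 < a -> argmin (penalized_objective f h W a) !=set0)
    (hs : version_indices e s)
    (hasync : partially_asynchronous e K s B D)
    (halpha : 0 < alpha < 2 * min_ord (fun i => W i i / L i))
    (hx : async_prox_dgd e f h W alpha K s x) :
  exists xstar : 'M[R]_(n.+1, d),
    [/\ sync_fixed_point f h W alpha xstar,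
        x k @[k --> \oo] --> xstar &
        forall mu : 'I_n.+1 -> R,
          (forall i, 0 < mu i) ->
          (forall i, strongly_convex (mu i) (f i)) ->
          let rho := Num.sqrt (1 - alpha *
            min_ord (fun i => mu i * (2 - alpha * L i / W i i))) in
          forall k : nat,
            block_max_norm (x k - xstar) <=
            rho ^+ (k %/ (B + D + 1)) * block_max_norm (x 0%N - xstar)].
Proof.
have [_ _ econn] := hgraph.
have [symW W_ge0 W_row _ W_graph] := hW.
have [s_le s_diag] := hs.
have [activeP s_ge] := hasync.
have [a_gt0 a_min] := andP halpha.
have W_nbhd i j : closed_nbhd e i j -> 0 < W i j by exact: (W_graph i j).1.
have W_diag i : 0 < W i i by apply: W_nbhd; rewrite /closed_nbhd eqxx.
have a_lt i : alpha * L i < 2 * W i i.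
  rewrite -ltr_pdivlMr // -mulrA; apply: lt_le_trans a_min _.
  by rewrite ler_pM2l // (min_ord_le (fun i => W i i / L i)).
have cf i : convex_fun (fun z => (f i z)%:E) by have [] := hf i.
have ch i : convex_fun (h i) by have [] := hh i.
have hNy i y : h i y != -oo%E by have [[]] := hh i.
have df i y : differentiable (f i) y := (hsmooth i).1 y.
(* This minimizer serves twice: it shows that the prox problems are solvable, and it is the initial
   fixed point. *)
have [zeta zetaP] := hmin alpha a_gt0.
have zeta_vi i := penalized_argmin_prox_vi df hNy symW ch i a_gt0 zetaP.
have prox_ex i : exists u p, prox_vi alpha (h i) u p.
  by eexists; eexists; exact: zeta_vi.
pose T := prox_dgd_map W f h alpha.
(* [s] is constrained only on neighbours and at active times. Setting the index to k elsewhere makes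
   the delay bound hold everywhere without changing an update, since the other weights vanish. *)
pose tau i j k := if closed_nbhd e i j && `[< K i k >] then s i j k else k.
pose z k i := row i (x k).
have tau_bound i j k : (k - D <= tau i j k <= k)%N.
  rewrite /tau; case: ifP => [/andP[+ /asboolP Ki]|_]; last by rewrite leq_subr leqnn.
  rewrite /closed_nbhd => /orP[/eqP ->|eij]; last exact: s_ge.
  by rewrite s_diag leq_subr leqnn.
have tau_diag i k : tau i i k = k by rewrite /tau s_diag if_same.
have z_active i k : K i k -> z k.+1 i = T i (fun j => z (tau i j k) j).
  move=> Ki; rewrite /T /prox_dgd_map /dgd_point.
  have -> : z k.+1 i = _ := (hx i k).1 Ki.
  rewrite tau_diag.
  apply: (congr1 (fun v => prox (scale_ext alpha (h i))
    (v - alpha *: grad (f i) (row i (x k))))).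
  rewrite big_mkcond /=.
  apply: eq_bigr => j _.
  rewrite /tau asboolT // andbT; case: ifPn => // nij.
  by rewrite ((W_graph i j).2 nij) scale0r.
have z_idle i k : ~ K i k -> z k.+1 i = z k i by exact: (hx i k).2.
have /choice[kappa kappaP] : forall i, exists kappa : R, 0 < kappa /\ forall X Y,
    dot (T i X - T i Y) (T i X - T i Y) + kappa * \sum_j W i j *
      dot (X j - Y j - (T i X - T i Y)) (X j - Y j - (T i X - T i Y))
    <= \sum_j W i j * dot (X j - Y j) (X j - Y j).
  move=> i; have [kappa k0 kP] := prox_dgd_map_averaged W_ge0 W_diag W_row cf hL
    hsmooth hh prox_ex a_gt0 a_lt i.
  by exists kappa.
have Tzeta : exists y, forall i, T i y = y i.
  exists (fun i => row i zeta) => i; apply: prox_vi_prox => //; exact: zeta_vi.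
have [y Ty ycvg] := async_converges W_ge0 W_row activeP tau_bound z_active z_idle
  W_nbhd econn tau_diag (fun i => (kappaP i).1) (fun i => (kappaP i).2) ord0 Tzeta.
pose xstar := \matrix_i y i.
have row_xstar k i : row i (x k - xstar) = z k i - y i by rewrite linearB /= rowK.
exists xstar; split.
- apply: prox_vi_sync_fixed_point => // i.
  have -> : (fun j => row j xstar) = y by apply: funext => j; rewrite rowK.
  have := prox_dgd_map_vi W f hh prox_ex a_gt0 i y.
  by rewrite -/(T i y) Ty rowK.
- apply: cvg_rows => eps /ycvg[N hN]; exists N => k i Nk.
  by rewrite row_xstar; exact: hN.
move=> mu mu_gt0 sc; set m := min_ord _ => rho k.
have m_ge0 : 0 <= m.
  apply: le_min_ord => i; rewrite mulr_ge0 ?ltW // subr_gt0.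
  by rewrite ltr_pdivrMr.
have rho0 : 0 <= rho := sqrtr_ge0 _.
have rho1 : rho ^+ 2 <= 1.
  rewrite expr_le1 // -sqrtr1 ler_wsqrtr // gerBl.
  by rewrite mulr_ge0 // ltW.
have block_le k' i : enorm (row i (x k' - xstar)) <= block_max_norm (x k' - xstar).
  exact: (le_bigmax _ (fun i => enorm (row i (x k' - xstar)))).
have block_ge0 : 0 <= block_max_norm (x 0%N - xstar).
  exact: le_trans (enorm_ge0 _) (block_le 0%N ord0).
have contr i X M : (forall j, dot (X j - y j) (X j - y j) <= M) ->
    dot (T i X - y i) (T i X - y i) <= rho ^+ 2 * M.
  move=> XM.
  have rho_i : 1 - alpha * (mu i * (2 - alpha * L i / W i i)) <= rho ^+ 2.
    apply: le_trans (le_sqr_sqrt _); rewrite lerD2l lerN2 ler_pM2l //.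
    exact: (min_ord_le (fun i => mu i * (2 - alpha * L i / W i i))).
  have := prox_dgd_map_contracts W_ge0 W_diag W_row cf hL hsmooth hh prox_ex
    a_gt0 a_lt (sc i) (mu_gt0 i) rho_i XM.
  by rewrite -/(T i X) -/(T i y) Ty.
have start i : dot (z 0%N i - y i) (z 0%N i - y i) <=
    block_max_norm (x 0%N - xstar) ^+ 2.
  by rewrite -row_xstar -enorm_le.
(* The rate is obtained for squared norms with factor rho^2; taking roots at the end restores
   rho. *)
have rate := async_rate activeP tau_bound z_active z_idle rho1 (sqr_ge0 _) contr start.
apply/bigmax_leP; split=> [|i _]; first by rewrite mulr_ge0 // exprn_ge0.
rewrite enorm_le ?mulr_ge0 ?exprn_ge0 // row_xstar exprMn exprAC.
by apply: rate; exact: leq_trunc_div.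
Qed.
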